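(* Let $b$ be a (possibly degenerate) alternating bilinear form on an $n$-dimensional vector space $V$ over a field of characteristic different from $2$, with Witt index $\nu$ and rank $r$. Let $\mathcal{V}$ be a linear subspace of $\mathcal{A}_b$ consisting only of nilpotent endomorphisms, with $\dim\mathcal{V}=\binom{n-r}{2}+r(n-r)+(\nu-n+r)(n-\nu-1)$. Then there exists a maximal partially complete $b$-singular flag $\mathcal{F}=(F_0,\dots,F_\nu)$ of $V$ such that $F_{n-r}=\mathrm{Rad}(b)$ and $\mathcal{V}$ equals the set of all nilpotent $b$-alternating endomorphisms of $V$ that stabilize $\mathcal{F}$.
   Context: $\mathrm{Rad}(b)=\{y\in V:\forall x\in V,\ b(x,y)=0\}$. The Witt index of $b$ is the maximal dimension of a totally singular subspace $X$ ($b(x,y)=0$ for all $x,y\in X$). An endomorphism $u$ is $b$-alternating if $(x,y)\mapsto b(x,u(y))$ is alternating (vanishes on all $(x,x)$); $\mathcal{A}_b$ is the space of these. A flag $(F_0,\dots,F_p)$ is an increasing sequence of subspaces; it is partially complete if $\dim F_i=i$ for all $i$, $b$-singular if $F_p$ is totally singular, and maximal if moreover $p$ is the Witt index of $b$. $u$ stabilizes the flag if $u(F_i)\subseteq F_i$ for all $i$. *)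

(* Defs.v *)
From HB Require Import structures.
From mathcomp Require Import all_boot all_order all_algebra.
Set Implicit Arguments. Unset Strict Implicit. Unset Printing Implicit Defensive.
Import GRing.Theory.
Local Open Scope ring_scope.

(* Vectors of V = F^n are row vectors 'rV[F]_n.  A bilinear form b is given by
   its Gram matrix B : b(x,y) = x B y^T.  An endomorphism u is given by a
   matrix U acting on row vectors: u(y) = y *m U. *)
Definition bform (F : fieldType) (n : nat) (B : 'M[F]_n) (x y : 'rV[F]_n) : F :=
  (x *m B *m y^T) 0 0.

Definition alt_form (F : fieldType) (n : nat) (B : 'M[F]_n) : Prop :=
  forall x : 'rV[F]_n, bform B x x = 0.

Definition b_alternating (F : fieldType) (n : nat) (B U : 'M[F]_n) : Prop :=
  forall x : 'rV[F]_n, bform B x (x *m U) = 0.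

Definition nilpotent_mx (F : fieldType) (n : nat) (U : 'M[F]_n) : Prop :=
  exists k : nat, U ^+ k = 0.

Definition totally_singular (F : fieldType) (n : nat) (B : 'M[F]_n)
  (X : {vspace 'rV[F]_n}) : Prop :=
  forall x y, x \in X -> y \in X -> bform B x y = 0.

Definition is_witt_index (F : fieldType) (n : nat) (B : 'M[F]_n) (nu : nat) : Prop :=
  (exists X : {vspace 'rV[F]_n}, totally_singular B X /\ \dim X = nu) /\
  (forall X : {vspace 'rV[F]_n}, totally_singular B X -> (\dim X <= nu)%N).

Definition pc_singular_flag (F : fieldType) (n : nat) (B : 'M[F]_n)
  (Fl : nat -> {vspace 'rV[F]_n}) (p : nat) : Prop :=
  (forall i, (i <= p)%N -> \dim (Fl i) = i) /\
  (forall i, (i < p)%N -> (Fl i <= Fl i.+1)%VS) /\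
  totally_singular B (Fl p).

Definition stabilizes_flag (F : fieldType) (n : nat) (U : 'M[F]_n)
  (Fl : nat -> {vspace 'rV[F]_n}) (p : nat) : Prop :=
  forall i, (i <= p)%N -> forall y, y \in Fl i -> y *m U \in Fl i.

(* Main.v *)
(** Let [S] be the space.  Since 2 is invertible, [tr (U V) = 0] and
    [tr (U^2 V) = 0] for all [U, V] in [S].  Fix [x <> 0], taken in the radical
    whenever the latter is nonzero, and let [V'] be [V / x] (radical case) or
    [x^perp / x] (symplectic case).  The elements of [S] killing [x] act on [V'],
    and the kernel of this action consists of "rank one" elements [E c], indexed
    by linear forms [c] on [V'].  As [tr (U (E c))] is proportional to [c (x U)],
    the first trace identity bounds [dim S] by [dim V' + dim S'], where [S'] is
    the induced space; the dimension bound follows by induction.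

    In the equality case the bound is attained at every such [x].  If [S] does
    not kill [x], the image of [x S] in [V'] is a nonzero [S']-stable subspace
    (second trace identity), so by induction it contains a nonzero vector killed
    by [S'], the image of some [x1 = x U].  Applying both identities to lifts of
    the rank one elements of [S'] attached to it yields [x1 U = 0], and nilpotency
    then shows that [x1] is killed by everything that kills [x].  Hence [x1] has a
    strictly larger annihilator in [S] than [x], and iterating produces a vector
    killed by [S].  Dividing it out gives the flag by induction. *)

Require Import Defs.
From HB Require Import structures.
From mathcomp Require Import all_boot all_order all_algebra all_fingroup.
From mathcomp Require Import zify ring.
Set Implicit Arguments. Unset Strict Implicit. Unset Printing Implicit Defensive.
Import GRing.Theory.
Local Open Scope ring_scope.

(** * Traces in linear spaces of nilpotent matrices *)

(** The reversed characteristic polynomial. The ring is arbitrary because matrices with polynomial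
    entries occur below. *)
Definition det1X (R : comNzRingType) (n : nat) (A : 'M[R]_n) : {poly R} :=
  \det (1%:M - 'X *: map_mx polyC A).

Lemma horner_det1X (R : comNzRingType) (n : nat) (A : 'M[R]_n) (a : R) :
  (det1X A).[a] = \det (1%:M - a *: A).
Proof.
rewrite /det1X -horner_evalE -det_map_mx; congr (\det _).
apply/matrixP=> i j; rewrite !mxE /= horner_evalE !hornerE.
by case: (i == j); rewrite ?hornerE.
Qed.

Lemma map_det1X (R S : comNzRingType) (f : {rmorphism R -> S}) (n : nat)
  (A : 'M[R]_n) : map_poly f (det1X A) = det1X (map_mx f A).
Proof.
rewrite /det1X -det_map_mx; congr (\det _).
apply/matrixP=> i j; rewrite !mxE rmorphB rmorphM /= map_polyX map_polyC /=.
by case: (i == j); rewrite ?rmorph1 ?rmorph0.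
Qed.

Lemma coef0_det1X (R : comNzRingType) (n : nat) (A : 'M[R]_n) :
  (det1X A)`_0 = 1.
Proof. by rewrite -horner_coef0 horner_det1X scale0r subr0 det1. Qed.

(** In the Leibniz expansion, a permutation other than the identity moves some [i] and also [s i];
    its product has two off-diagonal factors and is divisible by ['X^2]. *)
Lemma coef1_det1X (R : comNzRingType) (n : nat) (A : 'M[R]_n) :
  (det1X A)`_1 = - \tr A.
Proof.
rewrite /det1X /determinant (bigD1 (1%g : {perm 'I_n})) //= coefD coef_sum.
rewrite [X in _ + X]big1 ?addr0 => [|s s_neq1].
  rewrite odd_perm1 expr0 mul1r.
  suff: forall p, p = \prod_(i < n) (1%:M - 'X *: map_mx polyC A) i ((1%g : 'S_n) i) ->
      p`_0 = 1 /\ p`_1 = - \tr A by case/(_ _ erefl).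
  move=> _ ->.
  rewrite /mxtrace -sumrN; elim/big_rec2: _ => [|i t p _ [p0 p1]].
    by rewrite coef1 coef1.
  rewrite !mxE perm1 eqxx mulrBl mul1r -mulrA !coefB !coefXM /= coefCM p0 p1 mulr1.
  by rewrite subr0 addrC.
have [i si] : exists i, s i != i.
  apply/existsP; apply: contraNT s_neq1; rewrite negb_exists => /forallP fix_s.
  by apply/eqP/permP=> i; rewrite perm1; apply/eqP; have := fix_s i; rewrite negbK.
rewrite (bigD1 i) //= (bigD1 (s i)) //= !mxE.
rewrite [i == _]eq_sym (negPf si) [s i == _]eq_sym (inj_eq perm_inj) (negPf si).
rewrite !mulr0n !sub0r.
set p := \prod_(j < n | _) _.
have factorX (K : comNzRingType) (e y a b q : K) :
  e * (- (y * a) * (- (y * b) * q)) = y ^+ 2 * (e * a * b * q) by ring.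
by rewrite factorX coefXnM.
Qed.

(** An exponent of at least 3 gives the geometric sum of [U] a term of degree 2, which
    [tr_sqr_mul_nilpotent] reads off. *)
Lemma exp_mx0P (F : fieldType) (n : nat) (U : 'M[F]_n) :
  nilpotent_mx U -> exists k, U ^+ k.+3 = 0.
Proof. by case=> k Uk; exists k; rewrite -addn3 exprD Uk mul0r. Qed.

Definition geom_mx (F : fieldType) (n : nat) (U : 'M[F]_n) (k : nat) :
    'M[{poly F}]_n := \sum_(i < k) 'X^i *: map_mx polyC (U ^+ i).

Lemma geom_mxP (F : fieldType) (n : nat) (U : 'M[F]_n) (k : nat) :
  (1%:M - 'X *: map_mx polyC U) *m geom_mx U k
  = 1%:M - 'X^k *: map_mx polyC (U ^+ k).
Proof.
elim: k => [|k IH].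
  by rewrite /geom_mx big_ord0 mulmx0 expr0 scale1r expr0 map_mx1 subrr.
rewrite /geom_mx big_ord_recr /= mulmxDr IH mulmxBl mul1mx.
rewrite -scalemxAl -scalemxAr -map_mxM scalerA -exprS mulmxE -exprS.
by rewrite addrA subrK.
Qed.

(** The truncated geometric series inverts [1 - X U], so the determinant is a unit polynomial, hence
    equal to its constant coefficient. *)
Lemma det1X_nilpotent (F : fieldType) (n : nat) (U : 'M[F]_n) :
  nilpotent_mx U -> det1X U = 1.
Proof.
case=> k Uk; have := congr1 determinant (geom_mxP U k).
rewrite Uk map_mx0 scaler0 subr0 det1 det_mulmx -/(det1X U) => eq1.
have : det1X U \is a GRing.unit by apply/unitrPr; eexists; exact: eq1.
rewrite poly_unitE => /andP[/eqP/eq_leq/size1_polyC -> _].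
by rewrite coef0_det1X.
Qed.

Lemma tr_nilpotent (F : fieldType) (n : nat) (U : 'M[F]_n) :
  nilpotent_mx U -> \tr U = 0.
Proof.
move=> nilU; apply/oppr_inj; rewrite -coef1_det1X det1X_nilpotent //.
by rewrite coef1 oppr0.
Qed.

Lemma nilpotent_mx_sqr (F : fieldType) (n : nat) (U : 'M[F]_n) :
  nilpotent_mx U -> nilpotent_mx (U *m U).
Proof. by case=> k Uk; exists k; rewrite mulmxE -expr2 exprAC Uk expr0n. Qed.

(** Polarisation of [tr (W^2) = 0]. *)
Lemma tr_mul_nilpotent (F : fieldType) (n : nat) (U V : 'M[F]_n) :
  (2%:R : F) != 0 -> nilpotent_mx U -> nilpotent_mx V -> nilpotent_mx (U + V) ->
  \tr (U *m V) = 0.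
Proof.
move=> F2 /nilpotent_mx_sqr/tr_nilpotent U0 /nilpotent_mx_sqr/tr_nilpotent V0.
move=> /nilpotent_mx_sqr/tr_nilpotent.
rewrite mulmxDl !mulmxDr !mxtraceD U0 V0 add0r addr0 [\tr (V *m U)]mxtrace_mulC.
by rewrite -mulr2n -mulr_natl => /eqP; rewrite mulf_eq0 (negPf F2) => /eqP.
Qed.

(* [U, V] and [U + V], [U - V] being nilpotent, [det (1 - X U - Y V)] restricts
   to [1] on the lines [Y = 0], [X = 0], [Y = X] and [Y = - X]; hence its
   coefficient at [X^2 Y], which is [- tr (U^2 V)], vanishes.  Expanding
   [tr ((U + V)^3)] instead would lose the case of characteristic 3. *)
Lemma tr_sqr_mul_nilpotent (F : fieldType) (n : nat) (U V : 'M[F]_n) :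
  (2%:R : F) != 0 -> nilpotent_mx U -> nilpotent_mx V -> nilpotent_mx (U + V) ->
  nilpotent_mx (U - V) -> \tr (U *m U *m V) = 0.
Proof.
move=> F2 nU nV nUpV nUmV; have [k Uk] := exp_mx0P nU.
pose R := geom_mx U k.+3; pose g := det1X (R *m map_mx polyC V).
have UR : (1%:M - 'X *: map_mx polyC U) *m R = 1%:M.
  by rewrite geom_mxP Uk map_mx0 scaler0 subr0.
have gE a : g.[a] = \det (1%:M - 'X *: map_mx polyC U - a *: map_mx polyC V).
  rewrite horner_det1X -[LHS]mul1r -{1}(det1X_nilpotent nU) -det_mulmx.
  by rewrite mulmxBr mulmx1 -scalemxAr mulmxA UR mul1mx.
have gX : g.['X] = 1.
  rewrite gE; apply: etrans (det1X_nilpotent nUpV); congr (\det _).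
  by rewrite map_mxD scalerDr opprD addrA.
have gNX : g.[- 'X] = 1.
  rewrite gE; apply: etrans (det1X_nilpotent nUmV); congr (\det _).
  by rewrite map_mxB scalerBr opprB scaleNr opprK addrCA addrC.
have g0 : map_poly (horner_eval 0) g = 1.
  rewrite map_det1X map_mxM; apply: etrans (det1X_nilpotent nV); congr (det1X _).
  have -> : map_mx (horner_eval 0) R = 1%:M :> 'M[F]_n.
    apply/matrixP=> i j; rewrite mxE horner_evalE /R /geom_mx summxE.
    rewrite horner_sum big_ord_recl big1 ?addr0 => [|l _].
      by rewrite !mxE !hornerE.
    by rewrite !mxE !hornerE expr0n mul0r.
  by rewrite mul1mx; apply/matrixP=> i j; rewrite !mxE /= ?horner_evalE hornerC.
pose h := drop_poly 3 g.
have gdec : g = 1 + g`_1 *: 'X + g`_2 *: 'X^2 + h * 'X^3.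
  rewrite -[LHS](poly_take_drop 3) -/h; congr (_ + _).
  rewrite /take_poly poly_def !big_ord_recl big_ord0 /= coef0_det1X.
  by rewrite scale1r expr0 expr1 addr0 addrA.
have h0 a : a.[0] = 0 -> (h.[a]).[0] = 0.
  move=> a0; have := congr1 (fun p : {poly F} => p`_3) g0.
  rewrite coef_map coef1 /= horner_evalE => g30.
  have -> : (h.[a]).[0] = (h`_0).[0].
    have := horner_map (horner_eval 0) h a; rewrite /= !horner_evalE a0 => <-.
    by rewrite [LHS]horner_coef0 coef_map /= horner_evalE.
  by rewrite coef_drop_poly.
have g1 : g`_1 = - \tr (R *m map_mx polyC V) by apply: coef1_det1X.
(* The difference of the values of [g] at ['X] and [- 'X] isolates its odd part. After division by
   ['X], the coefficient at ['X^2] no longer sees [h], by [h0]. *)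
have : 2%:R * g`_1 + 'X^2 * (h.['X] + h.[- 'X]) = 0.
  apply: (mulfI (negbT (polyX_eq0 F))); rewrite mulr0.
  transitivity (g.['X] - g.[- 'X]); last by rewrite gX gNX subrr.
  rewrite [X in _ = X.['X] - _]gdec [X in _ = _ - X.[_]]gdec.
  rewrite !(hornerD, hornerM, hornerZ, hornerXn, hornerX, hornerC) /=.
  have odd_part (K : comNzRingType) (y a b c e : K) :
    y * (2%:R * a + y ^+ 2 * (c + e)) = 1 + a * y + b * y ^+ 2 + c * y ^+ 3
      - (1 + a * (- y) + b * (- y) ^+ 2 + e * (- y) ^+ 3) by ring.
  exact: odd_part.
move=> /(congr1 (fun p : {poly F} => p`_2)).
rewrite coefD coefXnM /= subnn coef0 -[_`_0]horner_coef0 hornerD.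
rewrite !h0 ?hornerN ?hornerX ?oppr0 // !addr0 -polyC_natr coefCM g1 coefN mulrN.
move/eqP; rewrite oppr_eq0 mulf_eq0 (negPf F2) /= => /eqP <-.
rewrite /R /geom_mx mulmx_suml raddf_sum coef_sum /=.
rewrite big_ord_recl big_ord_recl big_ord_recl big1 => [|i _] /=.
  rewrite /bump /= -!scalemxAl -!map_mxM !mxtraceZ !trace_map_mx !coefXnM /=.
  by rewrite !coefC /= !add0r addr0 mulmxE -expr2.
by rewrite -scalemxAl mxtraceZ coefXnM /bump.
Qed.

(** * Annihilators and projections *)

Lemma mulmx11 (R : comNzRingType) (n : nat) (A : 'M[R]_1) (v : 'rV[R]_n) :
  A *m v = A 0 0 *: v.
Proof. by rewrite {1}[A]mx11_scalar mul_scalar_mx. Qed.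

Lemma row_right_inv (F : fieldType) (n : nat) (x : 'rV[F]_n) :
  x != 0 -> exists xi : 'cV[F]_n, x *m xi = 1%:M.
Proof.
move=> x_neq0; have [j xj] : exists j, x 0 j != 0.
  apply/existsP; apply: contraNT x_neq0; rewrite negb_exists => /forallP x0.
  by apply/eqP/rowP=> j; rewrite mxE; apply/eqP; have := x0 j; rewrite negbK.
exists ((x 0 j)^-1 *: delta_mx j 0); rewrite -scalemxAr -colE.
by apply/matrixP=> i l; rewrite !mxE !ord1 eqxx mulVf.
Qed.

Lemma vspace_row_mx (F : fieldType) (n : nat) (X : {vspace 'rV[F]_n}) :
  exists A : 'M[F]_(\dim X, n), \rank A = \dim X /\ forall i, row i A \in X.
Proof.
exists (\matrix_(i < \dim X) (vbasis X)`_i); split=> [|i]; last first.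
  by rewrite rowK vbasis_mem // mem_nth // size_tuple.
apply/eqP; change (row_free (\matrix_(i < \dim X) (vbasis X)`_i)).
apply: inj_row_free => v; rewrite mulmx_sum_row => v0.
have/freeP fX := basis_free (vbasisP X).
apply/rowP=> i; rewrite mxE; apply: (fX (fun j => v 0 j)).
by rewrite -[RHS]v0; apply: eq_bigr => j _; rewrite rowK.
Qed.

Lemma dim_vspace_annihilator (F : fieldType) (n : nat)
  (X : {vspace 'rV[F]_n}) (Y : {vspace 'cV[F]_n}) :
  (forall x y, x \in X -> y \in Y -> x *m y = 0) -> (\dim X + \dim Y <= n)%N.
Proof.
move=> XY0; pose Y' := (linfun (@trmx F n 1) @: Y)%VS.
have dimY' : \dim Y' = \dim Y.
  apply: limg_dim_eq; apply/eqP; rewrite -subv0; apply/subvP=> y.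
  rewrite memv_cap memv_ker lfunE /= => /andP[_].
  by rewrite trmx_eq0 => /eqP->; rewrite mem0v.
have [A [rA AX]] := vspace_row_mx X; have [C [rC CY]] := vspace_row_mx Y'.
rewrite -dimY' -rA -rC -[\rank C]mxrank_tr; apply: mulmx0_rank_max.
apply/matrixP=> i j; rewrite !mxE.
have /memv_imgP[y yY] := CY j; rewrite lfunE /= => Cj.
have := XY0 _ _ (AX i) yY; rewrite -[y]trmxK -Cj.
move=> /matrixP/(_ 0 0); rewrite !mxE => XY0ij; rewrite -[RHS]XY0ij.
by apply: eq_bigr => l _; rewrite !mxE.
Qed.

(** In the equality case each space is the full annihilator of the other: adjoining [c] would break
    [dim_vspace_annihilator]. *)
Lemma annihilator_eqr (F : fieldType) (n : nat)
  (X : {vspace 'rV[F]_n}) (Y : {vspace 'cV[F]_n}) :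
  (forall x y, x \in X -> y \in Y -> x *m y = 0) -> (\dim X + \dim Y)%N = n ->
  forall c, (forall x, x \in X -> x *m c = 0) -> c \in Y.
Proof.
move=> XY0 dimXY c Xc0.
have : (\dim X + \dim (Y + <[c]>)%VS <= n)%N.
  apply: dim_vspace_annihilator => x _ xX /memv_addP[y yY [_ /vlineP[a ->] ->]].
  by rewrite mulmxDr -scalemxAr XY0 // Xc0 // scaler0 addr0.
rewrite -[X in (_ <= X)%N]dimXY leq_add2l => le_dim.
have /eqP -> : Y == (Y + <[c]>)%VS by rewrite eqEdim addvSl.
by rewrite memvE addvSr.
Qed.

Lemma annihilator_eql (F : fieldType) (n : nat)
  (X : {vspace 'rV[F]_n}) (Y : {vspace 'cV[F]_n}) :
  (forall x y, x \in X -> y \in Y -> x *m y = 0) -> (\dim X + \dim Y)%N = n ->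
  forall v, (forall y, y \in Y -> v *m y = 0) -> v \in X.
Proof.
move=> XY0 dimXY v vY0.
have : (\dim (X + <[v]>)%VS + \dim Y <= n)%N.
  apply: dim_vspace_annihilator => _ y /memv_addP[x xX [_ /vlineP[a ->] ->]] yY.
  by rewrite mulmxDl -scalemxAl XY0 // vY0 // scaler0 addr0.
rewrite -[X in (_ <= X)%N]dimXY leq_add2r => le_dim.
have /eqP -> : X == (X + <[v]>)%VS by rewrite eqEdim addvSl.
by rewrite memvE addvSr.
Qed.

(** [1 - A C] is idempotent, and its full-rank factorisation gives a projection and a section. The
    uses are [k = 1] for a radical vector and [k = 2] for a hyperbolic plane. *)
Lemma split_projection (F : fieldType) (n k : nat) (A : 'M[F]_(n, k)) (C : 'M[F]_(k, n)) :
  C *m A = 1%:M ->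
  exists m (pi : 'M[F]_(n, m)) (sg : 'M[F]_(m, n)),
    [/\ n = (k + m)%N, pi *m sg = 1%:M - A *m C, sg *m pi = 1%:M,
        C *m pi = 0 & sg *m A = 0].
Proof.
move=> CA; pose p := 1%:M - A *m C.
have Cp : C *m p = 0 by rewrite mulmxBr mulmx1 mulmxA CA mul1mx subrr.
have pA : p *m A = 0 by rewrite mulmxBl mul1mx -mulmxA CA mulmx1 subrr.
have pp : p *m p = p by rewrite {1}/p mulmxBl mul1mx -mulmxA Cp mulmx0 subr0.
have rk : (\rank C = k)%N.
  by apply/eqP; rewrite -/(row_free C); apply/row_freeP; exists A.
have pE := mulmx_base p.
have inl q := @row_full_inj _ _ _ q _ (col_base_full p).
have inr q := @row_free_inj _ q _ _ _ (row_base_free p).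
exists (\rank p); move: (col_base p) (row_base p) pE inl inr => pi sg pE inl inr.
exists pi, sg; split=> //.
- apply/eqP; rewrite eqn_leq; apply/andP; split.
    rewrite -{1}(mxrank1 F n) -[1%:M](subrK (A *m C)) addnC.
    apply: leq_trans (mxrank_add _ _) _; rewrite leq_add2l -{2}rk.
    exact: mxrankM_maxr.
  by rewrite -{1}rk; apply: mulmx0_rank_max.
- apply: inl; apply: inr.
  by rewrite mulmx1 mulmxA pE -mulmxA pE.
- by apply: inr; rewrite -mulmxA pE mul0mx.
by apply: inl; rewrite mulmxA pE mulmx0.
Qed.

(** Serves to put [y] on the line of [z]: otherwise [c] is a linear form to feed into the rank one
    elements attached to [z]. *)
Lemma row_line_dichotomy (F : fieldType) (n : nat) (z y : 'rV[F]_n) :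
  (exists a, y = a *: z) \/ (exists c : 'cV[F]_n, z *m c = 0 /\ y *m c = 1%:M).
Proof.
case: (boolP (y <= z)%MS) => [/sub_rVP|]; first by left.
rewrite submxE => /row_right_inv[xi yxi]; right.
by exists (cokermx z *m xi); rewrite !(mulmxA _ (cokermx z)) mulmx_coker mul0mx.
Qed.


(** * Reduction along a vector *)

(** Reads [b(x U, y) = b(x, y U)]; for skew [B] and invertible 2 this is the b-alternating property,
    by [b_alternatingP]. *)
Definition selfadj (F : fieldType) (n : nat) (B U : 'M[F]_n) : Prop :=
  U *m B = B *m U^T.

Lemma selfadj_sqr (F : fieldType) (n : nat) (B U : 'M[F]_n) :
  selfadj B U -> selfadj B (U *m U).
Proof. by rewrite /selfadj trmx_mul => sU; rewrite -mulmxA sU !mulmxA sU. Qed.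

Definition nil_space (F : fieldType) (n : nat) (B : 'M[F]_n)
  (S : {vspace 'M[F]_n}) : Prop :=
  forall U, U \in S -> selfadj B U /\ nilpotent_mx U.

(* [m] is the dimension of the quotient [V'] of [V] by [x], or of [x^perp] by [x];
   [pi] and [sg] are a projection to [V'] and a section of it, and [B'] is the
   induced form.  [E] parametrises by linear forms on [V'] the self-adjoint
   endomorphisms that kill [x] and induce [0] on [V']. *)
Record reduction (F : fieldType) (n m : nat) (B : 'M[F]_n) (B' : 'M[F]_m)
    (x : 'rV[F]_n) (pi : 'M[F]_(n, m)) (sg : 'M[F]_(m, n))
    (E : 'Hom('cV[F]_m, 'M[F]_n)) (k : F) : Prop := Reduction {
  red_neq0 : x != 0;
  red_k : k != 0;
  red_sgpi : sg *m pi = 1%:M;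
  red_xpi : x *m pi = 0;
  red_xU : forall U, selfadj B U -> exists a, x *m U = x *m U *m pi *m sg + a *: x;
  red_sgU : forall U, selfadj B U -> x *m U = 0 ->
    exists c : 'cV_m, sg *m U = sg *m U *m pi *m sg + c *m x;
  red_selfadj : forall U, selfadj B U -> x *m U = 0 -> selfadj B' (sg *m U *m pi);
  red_kerE : forall U, selfadj B U -> x *m U = 0 -> sg *m U *m pi = 0 ->
    exists c, U = E c;
  red_xE : forall c, x *m E c = 0;
  red_sgE : forall c, sg *m E c = c *m x;
  red_tr : forall U c, selfadj B U -> \tr (U *m E c) = k * (x *m U *m pi *m c) 0 0 }.

Definition red_space (F : fieldType) (n m : nat) (x : 'rV[F]_n)
    (pi : 'M[F]_(n, m)) (sg : 'M[F]_(m, n)) (S : {vspace 'M[F]_n}) :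
    {vspace 'M[F]_m} :=
  (linfun (mulmxr pi \o mulmx sg)
     @: (S :&: lker (linfun (mulmx x : 'M_n -> 'rV_n))))%VS.

Lemma red_spaceP (F : fieldType) (n m : nat) (x : 'rV[F]_n)
    (pi : 'M[F]_(n, m)) (sg : 'M[F]_(m, n)) (S : {vspace 'M[F]_n}) V :
  reflect (exists U, [/\ U \in S, x *m U = 0 & V = sg *m U *m pi])
          (V \in red_space x pi sg S).
Proof.
apply: (iffP memv_imgP) => [[U] | [U [US xU ->]]].
  by rewrite memv_cap memv_ker !lfunE /= => /andP[US /eqP xU] ->; exists U.
exists U; last by rewrite lfunE.
by rewrite memv_cap memv_ker US lfunE /= xU eqxx.
Qed.

Lemma nilpotent_eigen (F : fieldType) (n : nat) (U : 'M[F]_n) (x : 'rV[F]_n) (a : F) :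
  nilpotent_mx U -> x != 0 -> x *m U = a *: x -> a = 0.
Proof.
move=> [k Uk] x0 xU; have xUk j : x *m U ^+ j = a ^+ j *: x.
  elim: j => [|j IH]; first by rewrite !expr0 mulmx1 scale1r.
  by rewrite exprS -mulmxE mulmxA xU -scalemxAl IH scalerA exprS.
have /eqP := xUk k; rewrite Uk mulmx0 eq_sym scaler_eq0 (negPf x0) orbF.
by rewrite expf_eq0 => /andP[_ /eqP].
Qed.

Section Reduction.

Variables (F : fieldType) (n m : nat) (B : 'M[F]_n) (B' : 'M[F]_m).
Variables (x : 'rV[F]_n) (pi : 'M[F]_(n, m)) (sg : 'M[F]_(m, n)).
Variables (E : 'Hom('cV[F]_m, 'M[F]_n)) (k : F) (S : {vspace 'M[F]_n}).
Hypothesis F2 : (2%:R : F) != 0.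
Hypothesis red : reduction B B' x pi sg E k.
Hypothesis nilS : nil_space B S.

Let S' := red_space x pi sg S.
Let M' := (linfun (mulmxr pi \o (mulmx x : 'M_n -> 'rV_n)) @: S)%VS.
Let L' := (E @^-1: S)%VS.

Lemma red_sgEpi c : sg *m E c *m pi = 0.
Proof. by rewrite (red_sgE red) -mulmxA (red_xpi red) mulmx0. Qed.

(** [sg U^i] agrees with [V^i sg] up to multiples of [x], which [U] kills and [pi] forgets. *)
Lemma nil_space_red : nil_space B' S'.
Proof.
move=> _ /red_spaceP[U [US xU ->]]; have [saU [j Uj]] := nilS US.
split; first exact: red_selfadj red _ saU xU.
have [c] := red_sgU red saU xU; set V := sg *m U *m pi => sgU.
exists j; suff: forall i, exists d : 'cV_m,
    sg *m U ^+ i = V ^+ i *m sg + d *m x.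
  case/(_ j) => d /(congr1 (mulmxr pi)); rewrite /= Uj mulmx0 mul0mx mulmxDl.
  by rewrite -!mulmxA (red_xpi red) mulmx0 addr0 (red_sgpi red) mulmx1.
elim=> [|i [d IH]]; first by exists 0; rewrite !expr0 mulmx1 mul1mx mul0mx addr0.
exists (V ^+ i *m c).
rewrite exprSr -mulmxE mulmxA IH mulmxDl -[d *m x *m U]mulmxA xU mulmx0 addr0.
by rewrite -(mulmxA _ sg U) sgU mulmxDr exprSr -mulmxE !mulmxA.
Qed.

(** If [x U] vanishes in [V'], then [x] is an eigenvector of [U], and nilpotence makes the
    eigenvalue zero. *)
Lemma red_Sx U : U \in S -> x *m U *m pi = 0 -> x *m U = 0.
Proof.
move=> US xUpi; have [saU nilU] := nilS US; have [a] := red_xU red saU.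
rewrite xUpi mul0mx add0r => xU.
by rewrite xU (nilpotent_eigen nilU (red_neq0 red) xU) scale0r.
Qed.

Lemma nil_space_tr U V : U \in S -> V \in S -> \tr (U *m V) = 0.
Proof.
move=> US VS; have nil W : W \in S -> nilpotent_mx W by case/nilS.
by apply: tr_mul_nilpotent => //; apply: nil => //; exact: memvD.
Qed.

Lemma nil_space_tr2 U V : U \in S -> V \in S -> \tr (U *m U *m V) = 0.
Proof.
move=> US VS; have nil W : W \in S -> nilpotent_mx W by case/nilS.
by apply: tr_sqr_mul_nilpotent => //; apply: nil => //; [exact: memvD | exact: memvB].
Qed.

Lemma red_orth U c : U \in S -> E c \in S -> x *m U *m pi *m c = 0.
Proof.
move=> US ES; have := nil_space_tr US ES; rewrite (red_tr red); last by case: (nilS US).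
move/eqP; rewrite mulf_eq0 (negPf (red_k red)) /= => /eqP e0.
by rewrite [LHS]mx11_scalar e0; apply/matrixP=> i j; rewrite !mxE mul0rn.
Qed.

(** Rank-nullity is applied to [U -> x U] into [V'], then to the action on [V'] of the elements
    killing [x]. The last kernel is the image of [L'] under [E], which is injective because
    [sg E c = c x] with [x] nonzero. *)
Lemma red_dimE : \dim S = (\dim M' + \dim L' + \dim S')%N.
Proof.
have Sx : (S :&: lker (linfun (mulmxr pi \o (mulmx x : 'M_n -> 'rV_n))) =
           S :&: lker (linfun (mulmx x : 'M_n -> 'rV_n)))%VS.
  apply/vspaceP=> U; rewrite !memv_cap !memv_ker !lfunE /=.
  apply/andP/andP=> -[US /eqP xU]; split=> //; apply/eqP; first exact: red_Sx.
  by rewrite xU mul0mx.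
rewrite -(limg_ker_dim (linfun (mulmxr pi \o (mulmx x : 'M_n -> 'rV_n))) S) Sx.
rewrite -(limg_ker_dim (linfun (mulmxr pi \o mulmx sg))
   (S :&: lker (linfun (mulmx x : 'M_n -> 'rV_n)))) -/S' -/M'.
suff -> : \dim L' = \dim ((S :&: lker (linfun (mulmx x : 'M_n -> 'rV_n))) :&:
     lker (linfun (mulmxr pi \o mulmx sg))).
  by rewrite addnC addnA.
have -> : ((S :&: lker (linfun (mulmx x : 'M_n -> 'rV_n))) :&:
     lker (linfun (mulmxr pi \o mulmx sg)) = E @: L')%VS.
  apply/vspaceP=> U; rewrite !memv_cap !memv_ker !lfunE /=.
  apply/idP/memv_imgP => [/andP[/andP[US /eqP xU] /eqP sU] | [c]].
    have [c Uc] := red_kerE red (nilS US).1 xU sU.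
    by exists c; rewrite -?memv_preim -?Uc.
  rewrite -memv_preim => ES ->.
  by rewrite ES (red_xE red) red_sgEpi !eqxx.
rewrite limg_dim_eq //; apply/eqP; rewrite -subv0; apply/subvP=> c.
rewrite memv_cap memv_ker => /andP[_ /eqP Ec0].
have [xi xxi] := row_right_inv (red_neq0 red).
by rewrite -[c]mulmx1 -xxi mulmxA -(red_sgE red) Ec0 mulmx0 mul0mx mem0v.
Qed.

Lemma red_M'P v : reflect (exists2 U, U \in S & v = x *m U *m pi) (v \in M').
Proof.
apply: (iffP memv_imgP) => [[U US] | [U US ->]]; last by exists U; rewrite ?lfunE.
by rewrite lfunE /= => ->; exists U.
Qed.

Lemma red_M'L' v c : v \in M' -> c \in L' -> v *m c = 0.
Proof. by move=> /red_M'P[U US ->]; rewrite -memv_preim; apply: red_orth. Qed.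

Lemma red_dim_le : (\dim S <= m + \dim S')%N.
Proof. by rewrite red_dimE leq_add2r; apply: dim_vspace_annihilator red_M'L'. Qed.

Hypothesis dimS : (m + \dim S' <= \dim S)%N.

Lemma red_dimML : (\dim M' + \dim L')%N = m.
Proof.
apply/eqP; rewrite eqn_leq dim_vspace_annihilator; last exact: red_M'L'.
by move: dimS; rewrite {1}red_dimE leq_add2r.
Qed.

(** [M'] and [L'] are orthogonal by the first trace identity and now have complementary dimensions,
    so [L'] is the whole annihilator of [M']. *)
Lemma red_full c : (forall U, U \in S -> x *m U *m pi *m c = 0) -> E c \in S.
Proof.
move=> Sc; rewrite memv_preim; apply: (annihilator_eqr red_M'L' red_dimML) => v.
by case/red_M'P=> U US ->; apply: Sc.
Qed.

(** Dually, [M'] is the annihilator of [L']. Here [V] may lie outside [S]: squares and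
    anticommutators of elements of [S] qualify by the second trace identity. *)
Lemma red_closed V : selfadj B V -> (forall c, E c \in S -> \tr (V *m E c) = 0) ->
  exists2 U, U \in S & x *m V *m pi = x *m U *m pi.
Proof.
move=> saV trV; apply/red_M'P; apply: (annihilator_eql red_M'L' red_dimML) => c.
rewrite -memv_preim => ES; have := trV c ES; rewrite (red_tr red) //.
move/eqP; rewrite mulf_eq0 (negPf (red_k red)) /= => /eqP e0.
by rewrite [LHS]mx11_scalar e0; apply/matrixP=> i j; rewrite !mxE mul0rn.
Qed.

Lemma red_sqr U : U \in S -> exists2 V, V \in S & x *m (U *m U) *m pi = x *m V *m pi.
Proof.
move=> US; apply: red_closed => [|c ES]; last exact: nil_space_tr2.
by apply: selfadj_sqr; case: (nilS US).
Qed.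

(** As [x V = 0], the left-hand side is the image of [x (U V + V U)], and the anticommutator is
    self-adjoint while [U V] need not be. *)
Lemma red_stable U V : U \in S -> V \in S -> x *m V = 0 ->
  exists2 W, W \in S & x *m U *m pi *m (sg *m V *m pi) = x *m W *m pi.
Proof.
move=> US VS xV; have [a xU] := red_xU red (nilS US).1.
have -> : x *m U *m pi *m (sg *m V *m pi) = x *m (U *m V + V *m U) *m pi.
  rewrite mulmxDr !mulmxA xV mul0mx addr0 [in RHS]xU mulmxDl -scalemxAl xV.
  by rewrite scaler0 addr0.
apply: red_closed => [|c ES].
  have [[saU _] [saV _]] := (nilS US, nilS VS).
  rewrite /selfadj mulmxDl linearD /= !trmx_mul mulmxDr -!mulmxA saU saV !mulmxA.
  by rewrite saU saV addrC.
(* Polarisation of [tr (T^2 (E c)) = 0] at [T = U + V]. *)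
have := nil_space_tr2 (memvD US VS) ES.
rewrite mulmxDl !mulmxDr !mulmxDl !mxtraceD !nil_space_tr2 //.
by rewrite add0r addr0.
Qed.

Lemma red_descent U a :
  U \in S -> x *m U != 0 -> x *m (U *m U) *m pi = a *: (x *m U *m pi) ->
  (forall V, V \in S' -> x *m U *m pi *m V = 0) ->
  x *m U *m U = 0 /\ forall V, V \in S -> x *m V = 0 -> x *m U *m V = 0.
Proof.
move=> US x1_neq0 xUU killed; have [saU nilU] := nilS US.
have x0 := red_neq0 red.
have xUU0 : x *m U *m U = 0.
  have [b xU] := red_xU red saU; have [b'] := red_xU red (selfadj_sqr saU).
  rewrite xUU -scalemxAl -[_ *m sg](addrK (b *: x)) -xU scalerBr scalerA -addrA.
  rewrite -scaleNr -scalerDl; set e := - _ + b'; rewrite mulmxA => xUU'.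
  (* At this point [x U^2 = a x U + e x]. If [e] were nonzero, the nilpotent [e^-1 U (U - a)] would
     fix [x]. Once [e = 0], [x U] is an eigenvector of [U], so [x U^2 = 0]. *)
  have e0 : e = 0.
    apply/eqP; apply: contraT => e_neq0.
    have nilZ : nilpotent_mx (e^-1 *: (U *m (U - a%:M))).
      have [j Uj] := nilU; exists j.
      have com : U *m (U - a%:M) = (U - a%:M) *m U.
        by rewrite mulmxBr mulmxBl scalar_mxC.
      have pow i : (e^-1 *: (U *m (U - a%:M))) ^+ i =
         e^-1 ^+ i *: (U ^+ i *m (U - a%:M) ^+ i).
        elim: i => [|i IH]; first by rewrite !expr0 mulmx1 scale1r.
        rewrite exprS IH -mulmxE -scalemxAl -scalemxAr scalerA -exprS.
        rewrite !exprS -!mulmxE; congr (_ *: _).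
        have comi : (U - a%:M) *m U ^+ i = U ^+ i *m (U - a%:M).
          by apply: (@commrX _ (U - a%:M) U i); rewrite /GRing.comm -!mulmxE.
        by rewrite -!mulmxA; congr (_ *m _); rewrite [LHS]mulmxA comi -mulmxA.
      by rewrite pow Uj mul0mx scaler0.
    have : x *m (e^-1 *: (U *m (U - a%:M))) = 1 *: x.
      rewrite -scalemxAr mulmxA mulmxBr xUU' mul_mx_scalar.
      by rewrite [a *: _ + _]addrC addrK scalerA mulVf.
    by move/(nilpotent_eigen nilZ x0)/eqP; rewrite oner_eq0.
  move: xUU'; rewrite e0 scale0r addr0 => xUU'.
  by rewrite xUU' (nilpotent_eigen nilU x1_neq0 xUU') scale0r.
split=> // V VS xV; have [saV nilV] := nilS VS.
(* [x U V = x (U V + V U)] vanishes in [V'], so [red_xU] for the anticommutator makes it a multiple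
   [b *: x]. *)
have : selfadj B (U *m V + V *m U).
  rewrite /selfadj mulmxDl linearD /= !trmx_mul mulmxDr -!mulmxA saU saV !mulmxA.
  by rewrite saU saV addrC.
case/(red_xU red) => b; rewrite mulmxDr !mulmxA xV mul0mx addr0.
have -> : x *m U *m V *m pi = 0.
  have V'S' : sg *m V *m pi \in S' by apply/red_spaceP; exists V.
  rewrite -[RHS](killed _ V'S') !mulmxA; have [c xU] := red_xU red saU.
  by rewrite {1}xU mulmxDl -scalemxAl xV scaler0 addr0.
rewrite mul0mx add0r => xUV; rewrite xUV.
have [-> | b_neq0] := eqVneq b 0; first by rewrite scale0r.
(* For nonzero [b], [T = U + b^-1 V] satisfies [x T^2 = x], against nilpotence. *)
have TS : U + b^-1 *: V \in S by rewrite memvD // memvZ.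
have nilT := nilpotent_mx_sqr (nilS TS).2.
have : x *m ((U + b^-1 *: V) *m (U + b^-1 *: V)) = 1 *: x.
  have xT : x *m (U + b^-1 *: V) = x *m U by rewrite mulmxDr -scalemxAr xV scaler0 addr0.
  by rewrite mulmxA xT mulmxDr xUU0 add0r -scalemxAr xUV scalerA mulVf.
by move/(nilpotent_eigen nilT x0)/eqP; rewrite oner_eq0.
Qed.

End Reduction.

(** * The radical and symplectic reductions *)

Lemma trmx11 (R : Type) (A : 'M[R]_1) : A^T = A.
Proof. by apply/matrixP=> i j; rewrite mxE !ord1. Qed.

Lemma skew_quad0 (F : fieldType) (n : nat) (A : 'M[F]_n) (v : 'rV[F]_n) :
  (2%:R : F) != 0 -> A^T = - A -> v *m A *m v^T = 0.
Proof.
move=> F2 sA; have : v *m A *m v^T = - (v *m A *m v^T).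
  by rewrite -{1}[_ *m _ *m _]trmx11 !trmx_mul trmxK sA mulNmx mulmxN mulmxA.
move/eqP; rewrite -addr_eq0 -mulr2n -scaler_nat scaler_eq0 (negPf F2) /=.
by move/eqP.
Qed.

Lemma selfadj_quad0 (F : fieldType) (n : nat) (B U : 'M[F]_n) (v : 'rV[F]_n) :
  (2%:R : F) != 0 -> B^T = - B -> selfadj B U -> v *m U *m B *m v^T = 0.
Proof.
move=> F2 sB saU; rewrite -[v *m U *m B]mulmxA; apply: skew_quad0 => //.
by rewrite trmx_mul sB mulNmx -saU.
Qed.

(** The error term [xi x] of [pi sg] is killed by [B], so the form descends to [V / x]. Maps killing
    [x] and inducing 0 send [V] into the line of [x], whence [E c = pi c x]. *)
Lemma reduction_radical (F : fieldType) (n : nat) (B : 'M[F]_n) (x : 'rV[F]_n) :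
  B^T = - B -> x != 0 -> x *m B = 0 ->
  exists m (pi : 'M[F]_(n, m)) (sg : 'M[F]_(m, n)) (xi : 'cV[F]_n),
  [/\ n = m.+1, pi *m sg = 1%:M - xi *m x &
      reduction B (sg *m B *m sg^T) x pi sg (linfun (mulmxr x \o mulmx pi)) 1].
Proof.
move=> sB x0 xB; have [xi xxi] := row_right_inv x0.
have Bx : B *m x^T = 0.
  by apply: trmx_inj; rewrite trmx_mul trmxK sB mulmxN xB oppr0 trmx0.
have [m [pi [sg [nm pisg sgpi xpi sgxi]]]] := split_projection xxi.
exists m, pi, sg, xi; split=> //; split=> //.
- exact: oner_neq0.
- move=> U _; exists ((x *m U *m xi) 0 0).
  by rewrite -mulmx11 -(mulmxA _ pi) pisg mulmxBr mulmx1 !mulmxA subrK.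
- move=> U _ _; exists (sg *m U *m xi).
  by rewrite -mulmxA pisg mulmxBr mulmx1 !mulmxA subrK.
- move=> U saU _; rewrite /selfadj !trmx_mul !mulmxA.
  rewrite -[sg *m U *m pi *m sg]mulmxA pisg -[sg *m B *m sg^T *m pi^T]mulmxA.
  rewrite -trmx_mul pisg [(_ - _)^T]linearB /= trmx1 trmx_mul !mulmxBr !mulmxBl !mulmx1.
  rewrite !mulmxA -[sg *m U *m xi *m x *m B]mulmxA xB mulmx0 mul0mx subr0.
  by rewrite -[sg *m B *m x^T]mulmxA Bx mulmx0 !mul0mx subr0 -(mulmxA sg) saU mulmxA.
- move=> U saU xU sUpi; exists (sg *m U *m xi); rewrite lfunE /=.
  rewrite -[LHS]mul1mx -[1%:M](subrK (xi *m x)) -pisg mulmxDl -(mulmxA xi) xU.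
  rewrite mulmx0 addr0 -!mulmxA; congr (_ *m _).
  rewrite -{1}[U]mulmx1 -[1%:M](subrK (xi *m x)) -pisg !mulmxDr !mulmxA sUpi.
  by rewrite mul0mx add0r.
- by move=> c; rewrite lfunE /= !mulmxA xpi !mul0mx.
- by move=> c; rewrite lfunE /= !mulmxA sgpi mul1mx.
move=> U c _; rewrite lfunE /= mul1r mulmxA mxtrace_mulC !mulmxA.
by rewrite /mxtrace big_ord_recl big_ord0 addr0.
Qed.

(* For [c = B y^T] this is the self-adjoint map [v |-> b(v,y) z - b(v,z) y]. *)
Definition skew_mx (F : fieldType) (n : nat) (B : 'M[F]_n) (z : 'rV[F]_n)
    (c : 'cV[F]_n) : 'M[F]_n := c *m z + B *m z^T *m c^T *m invmx B.

Definition skew_red (F : fieldType) (n m : nat) (B : 'M[F]_n) (x : 'rV[F]_n)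
    (pi : 'M[F]_(n, m)) : 'Hom('cV[F]_m, 'M[F]_n) :=
  linfun ((mulmxr x \o mulmx pi) \+
          (mulmx (B *m x^T) \o mulmxr (pi^T *m invmx B) \o trmx)).

Lemma skew_redE (F : fieldType) (n m : nat) (B : 'M[F]_n) (x : 'rV[F]_n)
    (pi : 'M[F]_(n, m)) c : skew_red B x pi c = skew_mx B x (pi *m c).
Proof. by rewrite lfunE /= /skew_mx trmx_mul !mulmxA. Qed.

Lemma invmx_skew (F : fieldType) (n : nat) (B : 'M[F]_n) :
  B \in unitmx -> B^T = - B -> (invmx B)^T = - invmx B.
Proof.
move=> uB sB; rewrite trmx_inv sB; apply: (can_inj (mulKmx (_ : - B \in unitmx))).
  by rewrite -sB unitmx_tr.
by rewrite mulmxV -?sB ?unitmx_tr // sB mulNmx mulmxN opprK mulmxV.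
Qed.

Lemma selfadj_skew_mx (F : fieldType) (n : nat) (B : 'M[F]_n) z c :
  B \in unitmx -> B^T = - B -> selfadj B (skew_mx B z c).
Proof.
move=> uB sB; rewrite /selfadj /skew_mx mulmxDl linearD /= !trmx_mul !trmxK.
rewrite invmx_skew // sB mulmxDr addrC mulmxKV //; congr (_ + _); first by rewrite !mulmxA.
by rewrite mulNmx !mulmxN !mulmxA opprK mulmxV // mul1mx.
Qed.

(** Both summands of [skew_mx] contribute [z U c], the second one as its transpose; hence the factor
    2. *)
Lemma tr_skew_mx (F : fieldType) (n : nat) (B U : 'M[F]_n) z c :
  B \in unitmx -> selfadj B U -> \tr (U *m skew_mx B z c) = 2%:R * (z *m U *m c) 0 0.
Proof.
move=> uB saU; rewrite /skew_mx mulmxDr mxtraceD !mulmxA saU.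
rewrite [X in X + _]mxtrace_mulC !mulmxA.
rewrite [X in _ + X]mxtrace_mulC !mulmxA mulVmx // mul1mx.
rewrite [X in _ + X]mxtrace_mulC !mulmxA.
rewrite -[X in _ + \tr X]trmx11 !trmx_mul !trmxK mulmxA.
by rewrite /mxtrace !big_ord_recl !big_ord0 !addr0 -mulr2n mulr_natl.
Qed.

(** [x^perp / x] is realised as the orthogonal complement of the hyperbolic plane spanned by [x] and
    some [z] with [b(x, z) = 1]: the rows of [sg] span the complement, and [pi] projects along the
    plane. *)
Lemma reduction_symplectic (F : fieldType) (n : nat) (B : 'M[F]_n) (x : 'rV[F]_n) :
  (2%:R : F) != 0 -> B^T = - B -> B \in unitmx -> x != 0 ->
  exists m (pi : 'M[F]_(n, m)) (sg : 'M[F]_(m, n)) (z : 'rV[F]_n),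
  [/\ n = m.+2, pi *m sg = 1%:M - (B *m z^T *m x - B *m x^T *m z),
      sg *m B *m x^T = 0,
      sg *m B *m sg^T \in unitmx /\
      invmx (sg *m B *m sg^T) = pi^T *m invmx B *m pi &
      reduction B (sg *m B *m sg^T) x pi sg (skew_red B x pi) 2%:R].
Proof.
move=> F2 sB uB x0.
have [w xw] := row_right_inv x0; pose z := (invmx B *m w)^T.
have xBz : x *m B *m z^T = 1%:M by rewrite /z trmxK mulmxA mulmxK.
have zBx : z *m B *m x^T = - 1%:M.
  by rewrite -[LHS]trmx11 !trmx_mul trmxK sB mulNmx mulmxN mulmxA xBz.
have q0 (v : 'rV_n) : v *m B *m v^T = 0 by apply: skew_quad0.
pose A := row_mx (B *m z^T) (- (B *m x^T)); pose C := col_mx x z.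
have CA : C *m A = 1%:M.
  rewrite mul_col_row !mulmxN !mulmxA xBz zBx !q0 oppr0 opprK.
  by rewrite -scalar_mx_block.
have [m [pi [sg [nm pisg sgpi Cpi sgA]]]] := split_projection CA.
move: Cpi; rewrite mul_col_mx -col_mx0 => /eq_col_mx[xpi zpi].
move: sgA; rewrite mul_mx_row -row_mx0 => /eq_row_mx[]; rewrite mulmxN !mulmxA.
move=> sgBz /eqP; rewrite oppr_eq0 => /eqP sgBx.
rewrite mul_row_col mulNmx in pisg.
have xBsg : x *m B *m sg^T = 0.
  by apply: trmx_inj; rewrite !trmx_mul trmxK sB mulNmx mulmxN mulmxA sgBx oppr0 trmx0.
(* The projection [pi sg] is self-adjoint; this is what transports self-adjointness to [V'] and
   yields the inverse of the induced form. *)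
have pB : pi *m sg *m B = B *m sg^T *m pi^T.
  rewrite -(mulmxA B) -trmx_mul pisg [(_ - _)^T]linearB /= [(_ - _)^T]linearB /=.
  rewrite trmx1 !trmx_mul sB !trmxK !mulmxBl !mulmxBr mul1mx mulmx1.
  by rewrite !mulmxN !mulmxA opprK [X in _ = _ - X]addrC.
have invB : sg *m B *m sg^T *m (pi^T *m invmx B *m pi) = 1%:M.
  rewrite !mulmxA -(mulmxA sg B) -(mulmxA sg _ pi^T) -pB !mulmxA mulmxK //.
  by rewrite sgpi mul1mx sgpi.
have [uB' _] := mulmx1_unit invB.
exists m, pi, sg, z; split=> //; split=> //.
- by rewrite -[RHS](mulKmx uB') invB mulmx1.
- move=> U saU; exists ((x *m U *m B *m z^T) 0 0).
  rewrite -mulmx11 -(mulmxA _ pi) pisg mulmxBr mulmx1 mulmxBr !mulmxA.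
  by rewrite selfadj_quad0 // mul0mx subr0 subrK.
- move=> U saU xU; exists (sg *m U *m B *m z^T).
  rewrite -(mulmxA _ pi) pisg mulmxBr mulmx1 mulmxBr !mulmxA.
  have -> : sg *m U *m B *m x^T = 0.
    by rewrite -(mulmxA sg) saU -!mulmxA -trmx_mul xU trmx0 !mulmx0.
  by rewrite mul0mx subr0 subrK.
- move=> U saU xU; rewrite /selfadj !trmx_mul !mulmxA.
  rewrite -(mulmxA sg B) -(mulmxA sg _ pi^T) -pB !mulmxA sgpi mul1mx.
  have sps : sg^T *m pi^T *m sg^T = sg^T by rewrite -!trmx_mul mulmxA sgpi mul1mx.
  rewrite -(mulmxA _ pi sg) -(mulmxA _ (pi *m sg) B) pB !mulmxA.
  rewrite -(mulmxA _ sg^T pi^T) -(mulmxA _ (sg^T *m pi^T)) sps -(mulmxA sg U) saU.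
  by rewrite mulmxA.
- move=> U saU xU sUpi; exists (sg *m U *m B *m z^T); rewrite skew_redE /skew_mx.
  set c := sg *m U *m B *m z^T.
  (* As [x U = 0], the map [U] is determined by [sg U] and [z U]. Self-adjointness expresses both
     through the single column [c]. *)
  have UE : U = pi *m sg *m U - B *m x^T *m z *m U.
    rewrite pisg !mulmxBl mul1mx -(mulmxA _ x) xU mulmx0 sub0r opprK.
    by rewrite addrK.
  have sgU : sg *m U = c *m x.
    apply/eqP; rewrite -subr_eq0; apply/eqP.
    have : sg *m U *m pi *m sg = 0 by rewrite sUpi mul0mx.
    rewrite -(mulmxA _ pi) pisg mulmxBr mulmx1 mulmxBr !mulmxA.
    have -> : sg *m U *m B *m x^T = 0.
      by rewrite -(mulmxA sg) saU -!mulmxA -trmx_mul xU trmx0 !mulmx0.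
    by rewrite mul0mx subr0.
  have UBz : U *m B *m z^T = pi *m c.
    rewrite {1}UE !mulmxBl -(mulmxA _ z) -(mulmxA _ (z *m U)) -(mulmxA _ (z *m U *m B)).
    by rewrite selfadj_quad0 // mulmx0 subr0 /c !mulmxA.
  have zU : z *m U = - ((pi *m c)^T *m invmx B).
    rewrite -UBz !trmx_mul trmxK sB mulNmx mulmxN mulNmx opprK -saU mulmxA.
    by rewrite mulmxK.
  rewrite {1}UE -(mulmxA _ z) zU mulmxN opprK -(mulmxA pi) sgU; congr (_ + _).
    by rewrite mulmxA.
  by rewrite mulmxA.
- move=> c; rewrite skew_redE /skew_mx mulmxDr !mulmxA xpi q0 !mul0mx addr0 //.
- move=> c; rewrite skew_redE /skew_mx mulmxDr !mulmxA sgpi mul1mx sgBx !mul0mx.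
  by rewrite addr0.
by move=> U c saU; rewrite skew_redE tr_skew_mx // !mulmxA.
Qed.

(** * The dimension bound *)

(* [d] is the dimension of the radical and [2 * s] the rank of the form. *)
Definition opt_dim (d s : nat) : nat := ('C(d, 2) + 2 * s * d + s * s.-1)%N.

Lemma opt_dimSd d s : opt_dim d.+1 s = (d + s.*2 + opt_dim d s)%N.
Proof. by rewrite /opt_dim binS bin1 -muln2; lia. Qed.

Lemma opt_dimSs s : opt_dim 0 s.+1 = (s.*2 + opt_dim 0 s)%N.
Proof. by rewrite /opt_dim /= -muln2 !muln0; case: s => [|s] //=; lia. Qed.

(** [B' = sg B sg^T] and conversely [B = pi B' pi^T], because [x] is radical; each rank bounds the
    other. *)
Lemma rank_radical (F : fieldType) (n m : nat) (B : 'M[F]_n) (x : 'rV[F]_n)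
    (xi : 'cV[F]_n) (pi : 'M[F]_(n, m)) (sg : 'M[F]_(m, n)) :
  B^T = - B -> x *m B = 0 -> pi *m sg = 1%:M - xi *m x ->
  sg *m B = sg *m B *m sg^T *m pi^T /\ \rank (sg *m B *m sg^T) = \rank B.
Proof.
move=> sB xB pisg.
have Bx : B *m x^T = 0.
  by apply: trmx_inj; rewrite trmx_mul trmxK sB mulmxN xB oppr0 trmx0.
have Bp : B = B *m sg^T *m pi^T.
  rewrite -mulmxA -trmx_mul pisg [(_ - _)^T]linearB /= trmx1 trmx_mul.
  by rewrite mulmxBr mulmx1 mulmxA Bx mul0mx subr0.
have pB : B = pi *m sg *m B by rewrite pisg mulmxBl mul1mx -mulmxA xB mulmx0 subr0.
have BE : B = pi *m (sg *m B *m sg^T) *m pi^T by rewrite {1}pB {1}Bp !mulmxA.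
split; first by rewrite {1}Bp !mulmxA.
apply/eqP; rewrite eqn_leq; apply/andP; split.
  by rewrite (leq_trans (mxrankM_maxl _ _)) // mxrankM_maxr.
rewrite {1}BE.
by rewrite (leq_trans (mxrankM_maxl _ _)) // mxrankM_maxr.
Qed.

Lemma skew_congr (F : fieldType) (n m : nat) (B : 'M[F]_n) (sg : 'M[F]_(m, n)) :
  B^T = - B -> (sg *m B *m sg^T)^T = - (sg *m B *m sg^T).
Proof. by move=> sB; rewrite !trmx_mul trmxK sB mulNmx mulmxN mulmxA. Qed.

Lemma radical_neq0 (F : fieldType) (n : nat) (B : 'M[F]_n) :
  (\rank B < n)%N -> exists x : 'rV[F]_n, x != 0 /\ x *m B = 0.
Proof.
move=> rB; have /rowV0Pn[x /sub_kermxP xB x0] : kermx B != 0.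
  by rewrite -mxrank_eq0 mxrank_ker subn_eq0 -ltnNge.
by exists x.
Qed.

Lemma unitmx_rank (F : fieldType) (n : nat) (B : 'M[F]_n) :
  \rank B = n -> B \in unitmx.
Proof. by move=> rB; rewrite -row_free_unit /row_free rB. Qed.

Lemma bound_symplectic (F : fieldType) (s n : nat) (B : 'M[F]_n) S :
  (2%:R : F) != 0 -> n = s.*2 -> B^T = - B -> B \in unitmx -> nil_space B S ->
  (\dim S <= opt_dim 0 s)%N.
Proof.
move=> F2; elim: s n B S => [|s IH] n B S ns sB uB nilS.
  apply: leq_trans (dimvS (subvf S)) _.
  by rewrite dimvf /dim /= ns.
have [x x0] : exists x : 'rV[F]_n, x != 0.
  rewrite ns; exists (delta_mx 0 0); apply/eqP=> /matrixP/(_ 0 0)/eqP.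
  by rewrite !mxE oner_eq0.
have [m [pi [sg [z [nm _ _ [uB' _] red]]]]] := reduction_symplectic F2 sB uB x0.
have ms : m = s.*2 by lia.
rewrite opt_dimSs -ms; apply: leq_trans (red_dim_le F2 red nilS) _.
rewrite leq_add2l; apply: (IH _ (sg *m B *m sg^T)) => //; first exact: skew_congr.
exact: nil_space_red red nilS.
Qed.

Lemma bound (F : fieldType) (d s n : nat) (B : 'M[F]_n) S :
  (2%:R : F) != 0 -> n = (d + s.*2)%N -> B^T = - B -> \rank B = s.*2 ->
  nil_space B S -> (\dim S <= opt_dim d s)%N.
Proof.
move=> F2; elim: d n B S => [|d IH] n B S nds sB rB nilS.
  by apply: (bound_symplectic F2 nds sB _ nilS); rewrite unitmx_rank // rB nds.
have [x [x0 xB]] : exists x : 'rV[F]_n, x != 0 /\ x *m B = 0.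
  by apply: radical_neq0; rewrite rB nds; lia.
have [m [pi [sg [xi [nm pisg red]]]]] := reduction_radical sB x0 xB.
have md : m = (d + s.*2)%N by lia.
rewrite opt_dimSd -md; apply: leq_trans (red_dim_le F2 red nilS) _.
rewrite leq_add2l; apply: (IH _ (sg *m B *m sg^T)) => //; first exact: skew_congr.
  by rewrite (rank_radical sB xB pisg).2.
exact: nil_space_red red nilS.
Qed.

(** When [S] kills [x], the condition in [red_full] is void, so equality puts all rank one elements
    attached to [x] into [S]. *)
Lemma full_radical (F : fieldType) (d s n : nat) (B : 'M[F]_n) S (x : 'rV[F]_n)
    (c : 'cV[F]_n) :
  (2%:R : F) != 0 -> n = (d.+1 + s.*2)%N -> B^T = - B -> \rank B = s.*2 ->
  nil_space B S -> \dim S = opt_dim d.+1 s ->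
  x != 0 -> x *m B = 0 -> (forall U, U \in S -> x *m U = 0) ->
  x *m c = 0 -> c *m x \in S.
Proof.
move=> F2 nds sB rB nilS dimS x0 xB killed xc.
have [m [pi [sg [xi [nm pisg red]]]]] := reduction_radical sB x0 xB.
have md : m = (d + s.*2)%N by lia.
have dimS' : (m + \dim (red_space x pi sg S) <= \dim S)%N.
  rewrite dimS opt_dimSd -md leq_add2l; apply: (bound F2 md _ _ (nil_space_red red nilS)).
    exact: skew_congr.
  by rewrite (rank_radical sB xB pisg).2.
have := red_full F2 red nilS dimS' (c := sg *m c).
rewrite lfunE /= mulmxA pisg mulmxBl mul1mx -(mulmxA xi) xc mulmx0 subr0; apply.
by move=> U /killed->; rewrite !mul0mx.
Qed.

Lemma full_symplectic (F : fieldType) (s n : nat) (B : 'M[F]_n) S (x : 'rV[F]_n)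
    (c : 'cV[F]_n) :
  (2%:R : F) != 0 -> n = s.+1.*2 -> B^T = - B -> B \in unitmx ->
  nil_space B S -> \dim S = opt_dim 0 s.+1 ->
  x != 0 -> (forall U, U \in S -> x *m U = 0) ->
  x *m c = 0 -> skew_mx B x c \in S.
Proof.
move=> F2 ns sB uB nilS dimS x0 killed xc.
have [m [pi [sg [z [nm pisg _ [uB' _] red]]]]] := reduction_symplectic F2 sB uB x0.
have ms : m = s.*2 by lia.
have dimS' : (m + \dim (red_space x pi sg S) <= \dim S)%N.
  rewrite dimS opt_dimSs -ms leq_add2l.
  by apply: (bound_symplectic F2 ms _ uB' (nil_space_red red nilS)); rewrite skew_congr.
have := red_full F2 red nilS dimS' (c := sg *m c).
rewrite skew_redE mulmxA pisg mulmxBl mul1mx mulmxBl -!(mulmxA _ _ c) xc mulmx0.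
rewrite sub0r opprK => fullS.
(* [pi sg c] differs from [c] by a multiple of [B x^T], on which [skew_mx B x] vanishes. *)
suff -> : skew_mx B x c = skew_mx B x (c + B *m (x^T *m (z *m c))).
  by rewrite mulmxA; apply: fullS => U /killed->; rewrite !mul0mx.
rewrite /skew_mx [z *m c]mx11_scalar mul_mx_scalar; set t := (z *m c) 0 0.
rewrite -scalemxAr mulmxDl -scalemxAl [(_ + _)^T]linearD /= [(_ *: _)^T]linearZ /=.
rewrite trmx_mul trmxK sB mulmxN scalerN mulmxBr mulmxBl -scalemxAr -scalemxAl.
by rewrite -!addrA; congr (_ + _); rewrite addrCA !mulmxA mulmxK // subrr addr0.
Qed.

(** * Descent to a common kernel vector *)

(* The trace identities for [U W] and [W^2 V] evaluate to [x U^2 pi c + z e] and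
   [(z e) (x U^2 pi c)] for one column [e]; both vanish, so [x U^2 pi c = 0]. *)
Lemma sqr_in_line_radical (F : fieldType) (n m : nat) (B : 'M[F]_n) B' x
    (pi : 'M[F]_(n, m)) (sg : 'M[F]_(m, n)) (xi : 'cV[F]_n) E k S U V W
    (z : 'rV[F]_m) (c : 'cV[F]_m) :
  (2%:R : F) != 0 -> nil_space B S -> reduction B B' x pi sg E k ->
  pi *m sg = 1%:M - xi *m x ->
  U \in S -> V \in S -> W \in S -> x *m W = 0 ->
  x *m U *m pi = z -> x *m (U *m U) *m pi = x *m V *m pi ->
  sg *m W *m pi = c *m z -> z *m c = 0 ->
  x *m (U *m U) *m pi *m c != 1%:M.
Proof.
move=> F2 nilS red pisg US VS WS xW xU xUV sW zc; apply/eqP=> UUc.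
have [sgpi xpi] := (red_sgpi red, red_xpi red).
have [e sWE] : exists e : 'cV_m, sg *m W = c *m z *m sg + e *m x.
  exists (sg *m W *m xi).
  by rewrite -sW -(mulmxA _ pi) pisg mulmxBr mulmx1 !mulmxA subrK.
have WE : W = pi *m (c *m z *m sg + e *m x).
  by rewrite -sWE mulmxA pisg mulmxBl mul1mx -mulmxA xW mulmx0 subr0.
have zU : z *m sg *m U *m pi *m c = 1%:M.
  have -> : z *m sg = x *m U - x *m U *m xi *m x.
    by rewrite -xU -(mulmxA _ pi sg) pisg mulmxBr mulmx1 mulmxA.
  move: (x *m U *m xi) => K; rewrite !mulmxBl -!(mulmxA K) xU zc mulmx0 subr0.
  by rewrite -UUc !mulmxA.
have ze : z *m e = - 1%:M.
  have := nil_space_tr F2 nilS US WS.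
  rewrite WE mulmxA mulmxDr mxtraceD !mulmxA.
  rewrite -(mulmxA _ z sg) mxtrace_mulC [X in _ + X]mxtrace_mulC !mulmxA zU xU.
  rewrite -mxtraceD trace_mx11 => h; apply/eqP; rewrite -addr_eq0 addrC.
  by rewrite [_ + _]mx11_scalar h raddf0.
have := nil_space_tr2 F2 nilS WS VS.
have -> : W *m W = - (pi *m c *m x).
  rewrite {1}WE -[LHS]mulmxA mulmxDl -(mulmxA e) xW mulmx0 addr0.
  rewrite -(mulmxA (c *m z)) sWE mulmxDr !mulmxA -!(mulmxA _ z c) zc mulmx0 !mul0mx add0r.
  by rewrite -(mulmxA _ z e) ze mulmxN mulmx1 mulNmx mulmxN mulmxA.
rewrite mulNmx raddfN /= mxtrace_mulC mulmxA mxtrace_mulC !mulmxA -xUV UUc mxtrace1.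
by move/eqP; rewrite oppr_eq0 oner_eq0.
Qed.

(** With [y = z sg] and [p = pi c], one has [W = skew_mx B y p + skew_mx B x r]. Were the product 1,
    [tr (U W) = 0] would give [y r = -1]; then [W^2] combines [- skew_mx B x p] with a multiple of
    [skew_mx B x (B y^T)], and [tr (W^2 V)] would be [-2]. *)
Lemma sqr_in_line_symplectic (F : fieldType) (n m : nat) (B : 'M[F]_n) x
    (pi : 'M[F]_(n, m)) (sg : 'M[F]_(m, n)) S U V W
    (z : 'rV[F]_m) (c : 'cV[F]_m) :
  (2%:R : F) != 0 -> B^T = - B -> B \in unitmx ->
  nil_space B S -> reduction B (sg *m B *m sg^T) x pi sg (skew_red B x pi) 2%:R ->
  sg *m B *m x^T = 0 ->
  invmx (sg *m B *m sg^T) = pi^T *m invmx B *m pi ->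
  U \in S -> V \in S -> W \in S -> x *m W = 0 ->
  x *m U *m pi = z -> x *m (U *m U) *m pi = x *m V *m pi ->
  sg *m W *m pi = skew_mx (sg *m B *m sg^T) z c -> z *m c = 0 ->
  x *m (U *m U) *m pi *m c != 1%:M.
Proof.
move=> F2 sB uB nilS red sgBx invB' US VS WS xW xU xUV sW zc; apply/eqP=> UUc.
have [sgpi xpi] := (red_sgpi red, red_xpi red).
have [saU _] := nilS _ US; have [saV _] := nilS _ VS; have [saW _] := nilS _ WS.
have xBsg : x *m B *m sg^T = 0.
  by apply: trmx_inj; rewrite !trmx_mul trmxK sB mulNmx mulmxN mulmxA sgBx oppr0 trmx0.
have q0 (v : 'rV_n) : v *m B *m v^T = 0 by apply: skew_quad0.
have [y Dy] : exists y, y = z *m sg by eexists.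
have [p Dp] : exists p, p = pi *m c by eexists.
have xp : x *m p = 0 by rewrite Dp mulmxA xpi mul0mx.
have yp : y *m p = 0 by rewrite Dp Dy mulmxA -(mulmxA z) sgpi mulmx1.
have xBy : x *m B *m y^T = 0 by rewrite Dy trmx_mul mulmxA xBsg mul0mx.
have yBx : y *m B *m x^T = 0.
  by apply: trmx_inj; rewrite !trmx_mul trmxK sB mulNmx mulmxN mulmxA xBy oppr0 trmx0.
(* The difference kills [x] and induces 0 on [V'], so [red_kerE] applies. *)
have [e We] : exists e, W - skew_mx B y p = skew_mx B x (pi *m e).
  have [||| e We] := red_kerE red (U := W - skew_mx B y p).
  - rewrite /selfadj mulmxBl saW selfadj_skew_mx // -mulmxBr.
    by rewrite [in RHS]linearB.
  - by rewrite mulmxBr xW /skew_mx mulmxDr !mulmxA xp xBy !mul0mx addr0 subr0.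
  - rewrite mulmxBr mulmxBl sW /skew_mx mulmxDr mulmxDl invB' Dp Dy !trmx_mul.
    by rewrite !mulmxA sgpi mul1mx -(mulmxA (c *m z)) sgpi mulmx1 subrr.
  by exists e; rewrite -skew_redE.
move: We => /eqP; rewrite subr_eq addrC => /eqP.
have [r Dr] : exists r, r = pi *m e by eexists.
rewrite -Dr => WE.
have xr : x *m r = 0 by rewrite Dr mulmxA xpi mul0mx.
have [b xUb] := red_xU red saU; rewrite xU -Dy in xUb.
have yE : y = x *m U - b *: x by rewrite xUb addrK.
have yUp : y *m U *m p = 1%:M.
  rewrite yE mulmxBl mulmxBl -!scalemxAl Dp !mulmxA xU zc scaler0 subr0.
  by rewrite -UUc !mulmxA.
have cancel2 (t : F) : 2%:R * t = 0 -> t = 0.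
  by move/eqP; rewrite mulf_eq0 (negPf F2) => /eqP.
have ze : y *m r = - 1%:M.
  have := nil_space_tr F2 nilS US WS.
  rewrite WE mulmxDr mxtraceD !tr_skew_mx // yUp -mulrDr => /cancel2.
  have -> : x *m U *m r = y *m r.
    by rewrite yE mulmxBl -scalemxAl xr scaler0 subr0.
  by move=> h; apply/eqP; rewrite -addr_eq0 addrC [_ + _]mx11_scalar mxE h raddf0.
have [f Df] : exists f, f = p^T *m invmx B by eexists.
have [g Dg] : exists g, g = r^T *m invmx B by eexists.
have [q Dq] : exists q, q = f *m r by eexists.
have WE' : W = p *m y + B *m y^T *m f + (r *m x + B *m x^T *m g).
  by rewrite WE /skew_mx Df Dg !mulmxA.
have invsk := invmx_skew uB sB.
have fp : f *m p = 0.
  by rewrite Df -{2}[p]trmxK; apply: skew_quad0.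
have gr : g *m r = 0.
  by rewrite Dg -{2}[r]trmxK; apply: skew_quad0.
have gp : g *m p = - q.
  by rewrite -[LHS]trmx11 Dq Df Dg !trmx_mul invsk trmxK mulNmx mulmxN mulmxA.
have dual (v : 'rV_n) (w : 'cV_n) : w^T *m invmx B *m B *m v^T = v *m w.
  by rewrite mulmxKV // -trmx_mul trmx11.
have yW : y *m W = - x.
  rewrite WE' !mulmxDr !mulmxA yp q0 ze yBx !mul0mx !add0r addr0.
  by rewrite mulNmx mul1mx.
have fW : f *m W = q *m x.
  rewrite WE' !mulmxDr !mulmxA fp -Dq [in f *m B]Df !dual yp xp !mul0mx !add0r addr0.
  by [].
have gW : g *m W = - (q *m y) - f.
  rewrite WE' !mulmxDr !mulmxA gp gr [in g *m B]Dg !dual ze xr !mul0mx !addr0.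
  by rewrite !mulNmx mul1mx.
have WW : W *m W = - (skew_mx B x p) + q 0 0 *: skew_mx B x (B *m y^T).
  have -> : skew_mx B x (B *m y^T) = B *m y^T *m x - B *m x^T *m y.
    by rewrite /skew_mx trmx_mul trmxK sB mulmxN -!mulmxA mulNmx mulmxK // !mulmxN.
  rewrite {1}WE' !mulmxDl -!(mulmxA _ _ W) yW fW xW gW mulmx0 add0r !mulmx11.
  rewrite /skew_mx -(mulmxA (B *m x^T)) -Df scalerBr !scalemxAr opprD mulmxN.
  by rewrite [- (_ *: y) - f]addrC mulmxDr !mulmxN addrACA.
have := nil_space_tr2 F2 nilS WS VS.
rewrite WW mxtrace_mulC mulmxDr mulmxN -scalemxAr mxtraceD [\tr (- _)]raddfN.
rewrite mxtraceZ /= !tr_skew_mx //.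
have -> : x *m V *m p = 1%:M by rewrite Dp mulmxA -xUV UUc.
(* [x V] and [x U^2] agree modulo [x], which is orthogonal to [y]; and [y] is [x U] minus a multiple
   of [x], so [selfadj_quad0] kills both remaining terms. *)
have -> : x *m V *m (B *m y^T) = 0.
  have [a xV] := red_xU red saV; have [a' xUU] := red_xU red (selfadj_sqr saU).
  have -> : x *m V *m (B *m y^T) = x *m (U *m U) *m (B *m y^T).
    by rewrite xV xUU -xUV !mulmxDl -!scalemxAl (mulmxA x B) xBy !scaler0.
  rewrite yE [(_ - _)^T]linearB /= [(_ *: _)^T]linearZ /= mulmxA mulmxBr -scalemxAr.
  rewrite (selfadj_quad0 _ F2 sB (selfadj_sqr saU)) scaler0 subr0 !mulmxA.
  exact: selfadj_quad0.
rewrite !mxE !mulr0 addr0 mulr1 => /eqP.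
by rewrite oppr_eq0 (negPf F2).
Qed.

Definition descends (F : fieldType) (n : nat) (S : {vspace 'M[F]_n}) (x x1 : 'rV[F]_n) :=
  (forall V, V \in S -> x *m V = 0 -> x1 *m V = 0) /\
  (exists2 U, U \in S & x1 *m U = 0 /\ x *m U != 0).

Definition killed_by (F : fieldType) (n : nat) (S : {vspace 'M[F]_n}) (x : 'rV[F]_n) :=
  forall U, U \in S -> x *m U = 0.

Lemma killed_dec (F : fieldType) (n : nat) (S : {vspace 'M[F]_n}) (x : 'rV[F]_n) :
  killed_by S x \/ exists2 U, U \in S & x *m U != 0.
Proof.
pose K := lker (linfun (mulmx x : 'M[F]_n -> 'rV_n)).
case: (boolP (S <= K)%VS) => [/subvP SK | /subvPn[U US]].
  by left=> U /SK; rewrite memv_ker lfunE => /eqP.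
by rewrite memv_ker lfunE /=; right; exists U.
Qed.

(** Each step strictly enlarges the annihilator in [S], so the induction is on its codimension. [P]
    carries the side conditions: nonzero, and radical where required. *)
Lemma killed_of_descends (F : fieldType) (n : nat) (S : {vspace 'M[F]_n})
    (P : 'rV[F]_n -> Prop) :
  (forall x U, P x -> U \in S -> x *m U != 0 -> exists2 x1, P x1 & descends S x x1) ->
  forall x, P x -> exists2 x1, P x1 & killed_by S x1.
Proof.
move=> desc; pose K x := (S :&: lker (linfun (mulmx x : 'M[F]_n -> 'rV_n)))%VS.
have KP x U : (U \in K x) = (U \in S) && (x *m U == 0).
  by rewrite memv_cap memv_ker lfunE.
move=> x; have [N] := ubnP (\dim S - \dim (K x)); elim: N x => // N IH x ltN Px.
have [kx | [U US xU]] := killed_dec S x; first by exists x.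
have [x1 Px1 [sub [V VS [x1V xV]]]] := desc x U Px US xU.
apply: (IH x1) => //.
have KK1 : (K x <= K x1)%VS.
  apply/subvP=> W; rewrite !KP => /andP[WS /eqP xW].
  by rewrite WS sub ?eqxx.
have : (\dim (K x) < \dim (K x1))%N.
  rewrite ltn_neqAle dimvS // andbT; apply/eqP=> eq_dim.
  have : K x == K x1 by rewrite eqEdim KK1 eq_dim leqnn.
  move=> /eqP/vspaceP/(_ V); rewrite !KP VS x1V eqxx (negPf xV).
  by [].
have : (\dim (K x1) <= \dim S)%N by apply: dimvS; apply: capvSl.
by move: ltN; lia.
Qed.

Lemma descent_radical (F : fieldType) (d s n : nat) (B : 'M[F]_n) S (x : 'rV[F]_n) U0 :
  (2%:R : F) != 0 ->
  (forall m (B' : 'M[F]_m) S', (0 < d)%N -> m = (d + s.*2)%N -> B'^T = - B' ->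
    \rank B' = s.*2 -> nil_space B' S' -> \dim S' = opt_dim d s ->
    exists2 z : 'rV[F]_m, z != 0 /\ z *m B' = 0 & killed_by S' z) ->
  n = (d.+1 + s.*2)%N -> B^T = - B -> \rank B = s.*2 ->
  nil_space B S -> \dim S = opt_dim d.+1 s ->
  x != 0 /\ x *m B = 0 -> U0 \in S -> x *m U0 != 0 ->
  exists2 x1, x1 != 0 /\ x1 *m B = 0 & descends S x x1.
Proof.
move=> F2 IH nds sB rB nilS dimS [x0 xB] U0S xU0.
have [m [pi [sg [xi [nm pisg red]]]]] := reduction_radical sB x0 xB.
have md : m = (d + s.*2)%N by lia.
have [sgB rB'] := rank_radical sB xB pisg; rewrite rB in rB'.
have sB' := skew_congr sg sB; have nilS' := nil_space_red red nilS.
set S' := red_space x pi sg S in nilS'; set B' := sg *m B *m sg^T in red rB' sB' nilS'.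
have leS' : (\dim S' <= opt_dim d s)%N by apply: bound F2 md sB' rB' nilS'.
have geS : (m + \dim S' <= \dim S)%N by rewrite dimS opt_dimSd -md leq_add2l.
have dimS' : \dim S' = opt_dim d s.
  apply/eqP; rewrite eqn_leq leS' /=.
  by have := red_dim_le F2 red nilS; rewrite dimS opt_dimSd -md leq_add2l.
have radS U : U \in S -> x *m U *m B = 0.
  by move=> /nilS[saU _]; rewrite -mulmxA saU mulmxA xB mul0mx.
pose m1 := x *m U0 *m pi.
have m1_neq0 : m1 != 0.
  by apply: contra xU0 => /eqP m10; apply/eqP; apply: red_Sx red nilS _ U0S m10.
have m1B : m1 *m B' = 0.
  rewrite /m1 /B' !mulmxA -(mulmxA _ pi) pisg mulmxBr mulmx1 !mulmxBl radS //.
  by rewrite !mulmxA -(mulmxA _ x B) xB mulmx0 !mul0mx subrr.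
(* For [d = 0] the form [B'] is nondegenerate and its radical cannot contain [m1]. *)
have d_gt0 : (0 < d)%N.
  rewrite lt0n; apply: contra m1_neq0 => /eqP d0; rewrite d0 in md.
  have uB' : B' \in unitmx by rewrite unitmx_rank // rB' md.
  by rewrite -(mulmxK uB' m1) m1B mul0mx.
have [z [z0 zB] kz] := IH m B' S' d_gt0 md sB' rB' nilS' dimS'.
have fullS' c : z *m c = 0 -> c *m z \in S'.
  case: d d_gt0 md dimS' {IH nds dimS leS'} => // d _ md dimS'.
  exact: (full_radical F2 md sB' rB' nilS' dimS' z0 zB kz).
(* If [m1] is off the line of [z], the element [c *m z] of [S'] maps it to [z], and [red_stable]
   keeps the result in the image of [x S]. *)
have [U US xU] : exists2 U, U \in S & x *m U *m pi = z.
  have [[a m1E] | [c [zc m1c]]] := row_line_dichotomy z m1.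
    exists (a^-1 *: U0); first exact: memvZ.
    rewrite -scalemxAr -scalemxAl -/m1 m1E scalerA mulVf ?scale1r //.
    by apply: contraNneq m1_neq0 => a0; rewrite m1E a0 scale0r.
  have /red_spaceP[V [VS xV Vcz]] := fullS' c zc.
  have [W WS] := red_stable F2 red nilS geS U0S VS xV.
  by rewrite -Vcz -/m1 mulmxA m1c mul1mx => ->; exists W.
have x1_neq0 : x *m U != 0.
  by apply: contraNneq z0 => xU0'; rewrite -xU xU0' mul0mx.
have [V VS xUV] := red_sqr F2 red nilS geS US.
have [a xUU] : exists a, x *m (U *m U) *m pi = a *: (x *m U *m pi).
  have [[a e] | [c [zc e]]] := row_line_dichotomy z (x *m (U *m U) *m pi).
    by exists a; rewrite xU.
  have /red_spaceP[W [WS xW Wcz]] := fullS' c zc.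
  have /eqP[] := sqr_in_line_radical F2 nilS red pisg US VS WS xW xU xUV
    (esym Wcz) zc.
  exact: e.
have killed W : W \in S' -> x *m U *m pi *m W = 0 by rewrite xU; apply: kz.
have [x1U sub] := red_descent red nilS US x1_neq0 xUU killed.
exists (x *m U); first by split=> //; exact: radS.
by split=> //; exists U.
Qed.

(** Unlike in the radical case, [skew_mx B' z c] sends [y] to [(y c) z] plus a term with coefficient
    [b'(y, z)]. Hence [z] is reached directly only from vectors orthogonal to it, and [m1] may first
    have to be moved. *)
Lemma descent_symplectic (F : fieldType) (s n : nat) (B : 'M[F]_n) S (x : 'rV[F]_n) U0 :
  (2%:R : F) != 0 ->
  (forall m (B' : 'M[F]_m) S', (0 < s)%N -> m = s.*2 -> B'^T = - B' ->
    B' \in unitmx -> nil_space B' S' -> \dim S' = opt_dim 0 s ->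
    exists2 z : 'rV[F]_m, z != 0 & killed_by S' z) ->
  n = s.+1.*2 -> B^T = - B -> B \in unitmx ->
  nil_space B S -> \dim S = opt_dim 0 s.+1 ->
  x != 0 -> U0 \in S -> x *m U0 != 0 ->
  exists2 x1, x1 != 0 & descends S x x1.
Proof.
move=> F2 IH ns sB uB nilS dimS x0 U0S xU0.
have [m [pi [sg [w [nm pisg sgBx [uB' invB'] red]]]]] :=
  reduction_symplectic F2 sB uB x0.
have ms : m = s.*2 by lia.
have sB' := skew_congr sg sB; have nilS' := nil_space_red red nilS.
set S' := red_space x pi sg S in nilS'.
have leS' : (\dim S' <= opt_dim 0 s)%N by apply: bound_symplectic F2 ms sB' uB' nilS'.
have geS : (m + \dim S' <= \dim S)%N by rewrite dimS opt_dimSs -ms leq_add2l.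
have dimS' : \dim S' = opt_dim 0 s.
  apply/eqP; rewrite eqn_leq leS' /=.
  by have := red_dim_le F2 red nilS; rewrite dimS opt_dimSs -ms leq_add2l.
pose m1 := x *m U0 *m pi.
have m1_neq0 : m1 != 0.
  by apply: contra xU0 => /eqP m10; apply/eqP; apply: red_Sx red nilS _ U0S m10.
have s_gt0 : (0 < s)%N.
  rewrite lt0n; apply: contra m1_neq0 => /eqP s0.
  by apply/eqP/rowP=> i; have := ltn_ord i; rewrite [X in (_ < X)%N]ms s0.
have fullS' z c : z != 0 -> killed_by S' z -> z *m c = 0 ->
    skew_mx (sg *m B *m sg^T) z c \in S'.
  case: s s_gt0 ms dimS' {IH ns dimS leS'} => // s _ ms dimS' z0 kz.
  exact: (full_symplectic F2 ms sB' uB' nilS' dimS' z0 kz).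
pose M v := exists2 U, U \in S & x *m U *m pi = v.
have Mstable v W : M v -> W \in S' -> M (v *m W).
  move=> [U US <-] /red_spaceP[V [VS xV ->]].
  by have [W' W'S ->] := red_stable F2 red nilS geS US VS xV; exists W'.
have MZ v a : M v -> M (a *: v).
  move=> [U US <-]; exists (a *: U); first exact: memvZ.
  by rewrite -scalemxAr -scalemxAl.
have Mm1 : M m1 by exists U0.
clearbody m1.
have [z [z0 kz [U US xU]]] : exists z, [/\ z != 0, killed_by S' z & M z].
  have [z z0 kz] := IH m _ S' s_gt0 ms sB' uB' nilS' dimS'.
  move: (sg *m B *m sg^T) sB' uB' fullS' => B' sB' uB' fullS'.
  have reach y c : y *m B' *m z^T = 0 -> z *m c = 0 -> y *m c = 1%:M -> M y -> M z.
    move=> yBz zc yc My; have := Mstable y _ My (fullS' z c z0 kz zc).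
    by rewrite /skew_mx mulmxDr !mulmxA yc yBz !mul0mx mul1mx addr0.
  have [[a m1E] | [c [zc m1c]]] := row_line_dichotomy z m1.
    exists z; split=> //; have := MZ _ a^-1 Mm1.
    rewrite m1E scalerA mulVf ?scale1r //.
    by apply: contraNneq m1_neq0 => a0; rewrite m1E a0 scale0r.
  have [m1Bz | m1Bz] := eqVneq (m1 *m B' *m z^T) 0.
    by exists z; split=> //; apply: reach m1Bz zc m1c Mm1.
  (* For [s = 1] the optimal dimension is 0, so [S'] is zero and [m1] itself is killed. *)
  have [s1 | s_neq1] := eqVneq s 1%N.
    exists m1; split=> // W; move: dimS'; rewrite s1 => /eqP; rewrite dimv_eq0 => /eqP ->.
    by rewrite memv0 => /eqP->; rewrite mulmx0.
  (* Now [m > 2], so such a [v] exists. Then [y = v B'^-1] is orthogonal to [z] and [m1] for [B'],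
     and [skew_mx B' z v^T] maps [m1] to a nonzero multiple of [y]. *)
  have [v v0 vzm] : exists2 v : 'rV[F]_m, v != 0 & v *m (col_mx z m1)^T = 0.
    have /rowV0Pn[v /sub_kermxP vK v0] : kermx (col_mx z m1)^T != 0.
      rewrite -mxrank_eq0 mxrank_ker subn_eq0 -ltnNge mxrank_tr.
      by apply: leq_ltn_trans (rank_leq_row _) _; lia.
    by exists v.
  have [zv m1v] : z *m v^T = 0 /\ m1 *m v^T = 0.
    apply: (@eq_col_mx _ 1 1 1); rewrite col_mx0 -mul_col_mx.
    by apply: trmx_inj; rewrite trmx_mul trmxK vzm trmx0.
  pose y := v *m invmx B'.
  have yB u : y *m B' *m u^T = (u *m v^T)^T by rewrite mulmxKV // trmx_mul trmxK.
  have y0 : y != 0.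
    by apply: contraNneq v0 => y0; rewrite -[v](mulmxKV uB') -/y y0 mul0mx.
  have My : M y.
    have := Mstable m1 _ Mm1 (fullS' z v^T z0 kz zv).
    rewrite /skew_mx mulmxDr !mulmxA m1v trmxK mul0mx add0r -(mulmxA _ v) -/y mulmx11.
    move/(MZ _ ((m1 *m B' *m z^T) 0 0)^-1); rewrite scalerA mulVf ?scale1r //.
    by apply: contraNneq m1Bz => t0; rewrite [_ *m z^T]mx11_scalar t0 raddf0.
  have [[a yE] | [c' [zc' yc']]] := row_line_dichotomy z y; last first.
    exists z; split=> //; apply: reach zc' yc' My.
    by rewrite yB zv trmx0.
  (* If [y] were on the line of [z], then [m1], orthogonal to [y], would be orthogonal to [z]. *)
  have a0 : a != 0 by apply: contraNneq y0 => a0; rewrite yE a0 scale0r.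
  case/eqP: m1Bz; apply: trmx_inj; rewrite !trmx_mul trmxK sB' mulNmx mulmxN mulmxA trmx0.
  apply: (scalerI a0); rewrite scaler0 scalerN scalemxAl scalemxAl -yE yB m1v.
  by rewrite trmx0 oppr0.
have x1_neq0 : x *m U != 0.
  by apply: contraNneq z0 => xU0'; rewrite -xU xU0' mul0mx.
have [V VS xUV] := red_sqr F2 red nilS geS US.
have [a xUU] : exists a, x *m (U *m U) *m pi = a *: (x *m U *m pi).
  have [[a e] | [c [zc e]]] := row_line_dichotomy z (x *m (U *m U) *m pi).
    by exists a; rewrite xU.
  have /red_spaceP[W [WS xW Wcz]] := fullS' z c z0 kz zc.
  have /eqP[] := sqr_in_line_symplectic F2 sB uB nilS red sgBx invB'
    US VS WS xW xU xUV (esym Wcz) zc.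
  exact: e.
have killed W : W \in S' -> x *m U *m pi *m W = 0 by rewrite xU; apply: kz.
have [x1U sub] := red_descent red nilS US x1_neq0 xUU killed.
by exists (x *m U) => //; split=> //; exists U.
Qed.

(** * Adapted bases *)

Lemma row_neq0_exists (F : fieldType) (n : nat) :
  (0 < n)%N -> exists x : 'rV[F]_n, x != 0.
Proof.
case: n => // n _; exists (delta_mx 0 0); apply/eqP=> /matrixP/(_ 0 0)/eqP.
by rewrite !mxE oner_eq0.
Qed.

Lemma killed_symplectic (F : fieldType) (s n : nat) (B : 'M[F]_n) S :
  (2%:R : F) != 0 -> (0 < s)%N -> n = s.*2 -> B^T = - B -> B \in unitmx ->
  nil_space B S -> \dim S = opt_dim 0 s ->
  exists2 x : 'rV[F]_n, x != 0 & killed_by S x.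
Proof.
move=> F2; elim: s n B S => // s IH n B S _ ns sB uB nilS dimS.
have [|x x0] := @row_neq0_exists F n; first by rewrite ns.
apply: killed_of_descends x0 => {}x U x0 US xU.
exact: (descent_symplectic F2 IH ns sB uB nilS dimS x0 US xU).
Qed.

Lemma killed_radical (F : fieldType) (d s n : nat) (B : 'M[F]_n) S :
  (2%:R : F) != 0 -> (0 < d)%N -> n = (d + s.*2)%N -> B^T = - B -> \rank B = s.*2 ->
  nil_space B S -> \dim S = opt_dim d s ->
  exists2 x : 'rV[F]_n, x != 0 /\ x *m B = 0 & killed_by S x.
Proof.
move=> F2; elim: d n B S => // d IH n B S _ nds sB rB nilS dimS.
have [|x Px] := @radical_neq0 F n B; first by rewrite rB nds; lia.
apply: (killed_of_descends (P := fun x => x != 0 /\ x *m B = 0)) Px => {}x U Px US xU.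
exact: (descent_radical F2 IH nds sB rB nilS dimS Px US xU).
Qed.

(** * Lifting singular sequences, and the Witt decomposition *)

Definition row_push (F : fieldType) (n m : nat) (sg : 'M[F]_(m, n)) :
    'Hom('rV[F]_m, 'rV[F]_n) := linfun (mulmxr sg : 'rV_m -> 'rV_n).

Lemma row_pushE (F : fieldType) (n m : nat) (sg : 'M[F]_(m, n)) v :
  row_push sg v = v *m sg.
Proof. exact: lfunE. Qed.

Section LiftSeq.

Variables (F : fieldType) (n m : nat) (x : 'rV[F]_n).
Variables (pi : 'M[F]_(n, m)) (sg : 'M[F]_(m, n)).
Hypotheses (x0 : x != 0) (xpi : x *m pi = 0) (sgpi : sg *m pi = 1%:M).

Definition lift_seq (E : seq 'rV[F]_m) : seq 'rV[F]_n :=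
  x :: map (row_push sg) E.

Lemma span_lift_seq E v :
  v \in <<E>>%VS -> v *m sg \in <<map (row_push sg) E>>%VS.
Proof.
move=> vE; rewrite -limg_span; have -> : v *m sg = row_push sg v by rewrite row_pushE.
exact: memv_img.
Qed.

Lemma free_lift_seq E : free E -> free (lift_seq E).
Proof.
move=> fE; rewrite free_cons; apply/andP; split.
  apply: contraNN x0; rewrite -limg_span => /memv_imgP[v _]; rewrite row_pushE => xE.
  by move: xpi; rewrite xE -mulmxA sgpi mulmx1 => ->; rewrite mul0mx.
rewrite /free size_map -limg_span limg_dim_eq //.
apply/eqP; rewrite -subv0; apply/subvP=> v; rewrite memv_cap memv_ker row_pushE.
case/andP=> _ /eqP v0; have := congr1 (mulmxr pi) v0.
by rewrite /= -mulmxA sgpi mulmx1 mul0mx => ->; rewrite mem0v.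
Qed.

Lemma singular_lift_seq (B : 'M[F]_n) E :
  x *m B *m x^T = 0 -> x *m B *m sg^T = 0 -> sg *m B *m x^T = 0 ->
  {in E &, forall v w, v *m (sg *m B *m sg^T) *m w^T = 0} ->
  {in lift_seq E &, forall v w, v *m B *m w^T = 0}.
Proof.
move=> xx xs sx EE v w; rewrite !inE => /orP[/eqP-> | /mapP[v' v'E ->]]
  /orP[/eqP-> | /mapP[w' w'E ->]] //; rewrite !row_pushE ?trmx_mul ?mulmxA.
- by rewrite xs mul0mx.
- by rewrite -!mulmxA (mulmxA sg) sx mulmx0.
by have := EE _ _ v'E w'E; rewrite !mulmxA.
Qed.

End LiftSeq.

Lemma span_singular (F : fieldType) (n : nat) (B : 'M[F]_n) (E : seq 'rV[F]_n) :
  {in E &, forall v w, v *m B *m w^T = 0} ->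
  {in <<E>>%VS &, forall v w, v *m B *m w^T = 0}.
Proof.
move=> EE; have step (c : 'cV[F]_n) :
    {in E, forall v, v *m c = 0} -> {in <<E>>%VS, forall v, v *m c = 0}.
  move=> Ec v; suff /subvP sub : (<<E>> <= lker (linfun (mulmxr c : 'rV_n -> 'rV_1)))%VS.
    by move/sub; rewrite memv_ker lfunE => /eqP.
  by apply/span_subvP=> w /Ec; rewrite memv_ker lfunE /= => ->.
move=> v w vE wE; rewrite -mulmxA; apply: (step _ _ v vE) => {vE}v vE.
apply: trmx_inj; rewrite trmx0 mulmxA trmx_mul trmxK.
by apply: (step _ _ w wE) => u uE; apply: trmx_inj; rewrite trmx_mul trmxK trmx0 EE.
Qed.

(** Shows that the rank is even and provides the singular space from which [witt_indexE] computes
    the Witt index. Strong induction on [n] removes a radical vector if there is one, and a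
    hyperbolic plane otherwise. *)
Lemma witt_decomposition (F : fieldType) (n : nat) (B : 'M[F]_n) :
  (2%:R : F) != 0 -> B^T = - B ->
  exists d s (E : seq 'rV[F]_n),
    [/\ n = (d + s.*2)%N, \rank B = s.*2, size E = (d + s)%N, free E &
        {in E &, forall v w, v *m B *m w^T = 0}].
Proof.
move=> F2; have [N] := ubnP n; elim: N n B => // N IH n B ltN sB.
have q0 (v : 'rV_n) : v *m B *m v^T = 0 by apply: skew_quad0.
case: (ltnP (\rank B) n) => [/radical_neq0[x [x0 xB]] | rB].
  have [m [pi [sg [xi [nm pisg red]]]]] := reduction_radical sB x0 xB.
  have [_ rB'] := rank_radical sB xB pisg.
  have [|d [s [E [mds rE sE fE EE]]]] := IH m (sg *m B *m sg^T) _ (skew_congr sg sB).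
    by lia.
  exists d.+1, s, (lift_seq x sg E); split=> //.
  - by lia.
  - by rewrite -rB' rE.
  - by rewrite /= size_map sE.
  - exact: (free_lift_seq (red_neq0 red) (red_xpi red) (red_sgpi red)).
  apply: singular_lift_seq; rewrite ?q0 ?xB ?mul0mx //.
  by apply: trmx_inj; rewrite !trmx_mul trmxK sB mulNmx mulmxN mulmxA xB mul0mx oppr0 trmx0.
have {}rB : \rank B = n by apply/eqP; rewrite eqn_leq rank_leq_row.
have uB := unitmx_rank rB.
case: (posnP n) => [n0 | n_gt0].
  exists 0, 0, [::]; split; rewrite ?nil_free //.
  by rewrite rB.
have [x x0] := row_neq0_exists F n_gt0.
have [m [pi [sg [w [nm pisg sgBx [uB' invB'] red]]]]] :=
  reduction_symplectic F2 sB uB x0.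
have [|d [s [E [mds rE sE fE EE]]]] := IH m (sg *m B *m sg^T) _ (skew_congr sg sB).
  by lia.
have d0 : d = 0.
  by move: rE; rewrite mxrank_unit // => rE; lia.
exists 0, s.+1, (lift_seq x sg E); split.
- by rewrite nm mds d0.
- by rewrite rB nm mds d0.
- by rewrite /= size_map sE d0.
- exact: (free_lift_seq (red_neq0 red) (red_xpi red) (red_sgpi red)).
apply: singular_lift_seq; rewrite ?q0 //.
by apply: trmx_inj; rewrite !trmx_mul trmxK sB mulNmx mulmxN mulmxA sgBx oppr0 trmx0.
Qed.

(** The flag is encoded by a free sequence whose prefixes span its members. Strict triangularity in
    the last clause combines stability with nilpotence, see [stabilized_adapted]. *)
Definition adapted_seq (F : fieldType) (n d s : nat) (B : 'M[F]_n) (S : {vspace 'M[F]_n})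
    (E : seq 'rV[F]_n) : Prop :=
  [/\ size E = (d + s)%N, free E, {in E &, forall v w, v *m B *m w^T = 0},
      forall y, y *m B = 0 <-> y \in <<take d E>>%VS &
      forall U, U \in S ->
        forall i, (i < d + s)%N -> E`_i *m U \in <<take i E>>%VS].

(** As [x U = 0], [U] sends a lift to the lift of the image plus a multiple of [x], which heads
    every nonempty prefix. *)
Lemma lift_adapted (F : fieldType) (n m : nat) (B : 'M[F]_n) B' x
    (pi : 'M[F]_(n, m)) (sg : 'M[F]_(m, n)) E k S (e : seq 'rV[F]_m) t :
  reduction B B' x pi sg E k -> nil_space B S -> killed_by S x -> size e = t ->
  (forall U, U \in red_space x pi sg S ->
     forall i, (i < t)%N -> e`_i *m U \in <<take i e>>%VS) ->
  forall U, U \in S -> forall i, (i < t.+1)%N ->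
     (lift_seq x sg e)`_i *m U \in <<take i (lift_seq x sg e)>>%VS.
Proof.
move=> red nilS kx se He U US [|i] /= lt_i; first by rewrite kx // mem0v.
rewrite (nth_map 0) ?se // row_pushE -mulmxA.
have [c ->] := red_sgU red (nilS _ US).1 (kx _ US).
have U'S' : sg *m U *m pi \in red_space x pi sg S.
  by apply/red_spaceP; exists U; rewrite kx.
rewrite mulmxDr (mulmxA e`_i _ sg) (mulmxA e`_i c) span_cons addrC mulmx11; apply: memv_add.
  by rewrite memvZ // memv_line.
by rewrite -map_take span_lift_seq // He.
Qed.

(** The killed vector heads [E]. The induced space is again optimal, squeezed between
    [bound_symplectic] and [red_dim_le]. *)
Lemma adapted_symplectic (F : fieldType) (s n : nat) (B : 'M[F]_n) S :
  (2%:R : F) != 0 -> n = s.*2 -> B^T = - B -> B \in unitmx ->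
  nil_space B S -> \dim S = opt_dim 0 s -> exists E, adapted_seq 0 s B S E.
Proof.
move=> F2; elim: s n B S => [|s IH] n B S ns sB uB nilS dimS.
  exists [::]; split; rewrite ?nil_free // => y.
  rewrite span_nil memv0; split=> [yB | /eqP ->]; last by rewrite mul0mx.
  by rewrite -(mulmxK uB y) yB mul0mx.
have [x x0 kx] := killed_symplectic F2 (ltn0Sn s) ns sB uB nilS dimS.
have [m [pi [sg [w [nm pisg sgBx [uB' invB'] red]]]]] :=
  reduction_symplectic F2 sB uB x0.
have ms : m = s.*2 by lia.
have sB' := skew_congr sg sB; have nilS' := nil_space_red red nilS.
have dimS' : \dim (red_space x pi sg S) = opt_dim 0 s.
  apply/eqP; rewrite eqn_leq (bound_symplectic F2 ms sB' uB' nilS') /=.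
  by have := red_dim_le F2 red nilS; rewrite dimS opt_dimSs -ms leq_add2l.
have [E [sE fE EE _ SE]] := IH m _ _ ms sB' uB' nilS' dimS'.
exists (lift_seq x sg E); split.
- by rewrite /= size_map sE.
- exact: (free_lift_seq (red_neq0 red) (red_xpi red) (red_sgpi red)).
- apply: singular_lift_seq => //; first exact: skew_quad0.
  by apply: trmx_inj; rewrite !trmx_mul trmxK sB mulNmx mulmxN mulmxA sgBx oppr0 trmx0.
- move=> y; rewrite take0 span_nil memv0; split=> [yB | /eqP ->]; last by rewrite mul0mx.
  by rewrite -(mulmxK uB y) yB mul0mx.
exact: (lift_adapted red nilS kx sE SE).
Qed.

Lemma adapted_exists (F : fieldType) (d s n : nat) (B : 'M[F]_n) S :
  (2%:R : F) != 0 -> n = (d + s.*2)%N -> B^T = - B -> \rank B = s.*2 ->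
  nil_space B S -> \dim S = opt_dim d s -> exists E, adapted_seq d s B S E.
Proof.
move=> F2; elim: d n B S => [|d IH] n B S nds sB rB nilS dimS.
  by apply: adapted_symplectic => //; rewrite unitmx_rank // rB nds.
have [x [x0 xB] kx] := killed_radical F2 (ltn0Sn d) nds sB rB nilS dimS.
have [m [pi [sg [xi [nm pisg red]]]]] := reduction_radical sB x0 xB.
have md : m = (d + s.*2)%N by lia.
have [sgB rB'] := rank_radical sB xB pisg; rewrite rB in rB'.
have sB' := skew_congr sg sB; have nilS' := nil_space_red red nilS.
have dimS' : \dim (red_space x pi sg S) = opt_dim d s.
  apply/eqP; rewrite eqn_leq (bound F2 md sB' rB' nilS') /=.
  by have := red_dim_le F2 red nilS; rewrite dimS opt_dimSd -md leq_add2l.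
have [E [sE fE EE RE SE]] := IH m _ _ md sB' rB' nilS' dimS'.
have Bx : B *m x^T = 0.
  by apply: trmx_inj; rewrite trmx_mul trmxK sB mulmxN xB oppr0 trmx0.
exists (lift_seq x sg E); split.
- by rewrite /= size_map sE.
- exact: (free_lift_seq (red_neq0 red) (red_xpi red) (red_sgpi red)).
- by apply: singular_lift_seq => //; rewrite ?xB -?mulmxA ?Bx ?mul0mx ?mulmx0.
(* A vector is radical exactly when its image in [V'] is. *)
- move=> y; rewrite /= span_cons -map_take -limg_span; split=> [yB | ].
    have -> : y = (y *m xi) 0 0 *: x + row_push sg (y *m pi).
      by rewrite row_pushE -mulmx11 -!mulmxA pisg mulmxBr mulmx1 addrC subrK.
    apply: memv_add; first by rewrite memvZ // memv_line.
    apply: memv_img; apply/RE; rewrite !mulmxA -(mulmxA y) pisg mulmxBr mulmx1.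
    by rewrite !mulmxBl yB !mulmxA -(mulmxA _ x B) xB mulmx0 !mul0mx subrr.
  move=> /memv_addP[_ /vlineP[a ->] [_ /memv_imgP[v /RE vB ->] ->]].
  rewrite row_pushE mulmxDl -scalemxAl xB scaler0 add0r -mulmxA sgB !mulmxA.
  by move: vB; rewrite !mulmxA => ->; rewrite mul0mx.
exact: (lift_adapted red nilS kx sE SE).
Qed.

(** * Alternating forms, the Witt index and nilpotence on flags *)

Lemma bform0 (F : fieldType) (n : nat) (B : 'M[F]_n) x y :
  bform B x y = 0 <-> x *m B *m y^T = 0.
Proof.
rewrite /bform; split=> [xy | ->]; last by rewrite mxE.
by rewrite [LHS]mx11_scalar xy raddf0.
Qed.

Lemma alternating_skew (F : fieldType) (n : nat) (A : 'M[F]_n) :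
  (forall x : 'rV[F]_n, x *m A *m x^T = 0) -> A^T = - A.
Proof.
move=> altA; apply/matrixP=> i j; rewrite !mxE.
pose e l : 'rV[F]_n := delta_mx 0 l.
have eA k l : (e k *m A *m (e l)^T) 0 0 = A k l.
  by rewrite /e -rowE trmx_delta -colE !mxE.
have := congr1 (fun M : 'M_1 => M 0 0) (altA (e i + e j)).
rewrite [(_ + _)^T]linearD /= !mulmxDl !mulmxDr !altA add0r addr0 !mxE.
have := eA i j; have := eA j i; rewrite !mxE => -> -> /eqP.
by rewrite addrC addr_eq0 => /eqP.
Qed.

Lemma b_alternatingP (F : fieldType) (n : nat) (B U : 'M[F]_n) :
  (2%:R : F) != 0 -> B^T = - B -> b_alternating B U <-> selfadj B U.
Proof.
move=> F2 sB; have sBU : (B *m U^T)^T = - (U *m B) by rewrite trmx_mul trmxK sB mulmxN.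
split=> [altU | saU x]; last first.
  apply/bform0; rewrite trmx_mul mulmxA -(mulmxA x); apply: skew_quad0 => //.
  by rewrite sBU saU.
have /alternating_skew : forall x : 'rV_n, x *m (B *m U^T) *m x^T = 0.
  by move=> x; have /bform0 := altU x; rewrite trmx_mul !mulmxA.
by rewrite sBU => /oppr_inj.
Qed.

(** For a basis matrix [A] of [X], [A (B A^T) = 0] bounds the rank of [B A^T] from above, and
    Sylvester's inequality bounds it from below. *)
Lemma dim_singular (F : fieldType) (n : nat) (B : 'M[F]_n) X :
  totally_singular B X -> (\dim X + \dim X + \rank B <= n + n)%N.
Proof.
move=> sX; have [A [rA AX]] := vspace_row_mx X.
have ABA : A *m (B *m A^T) = 0.
  apply/matrixP=> i j; rewrite mulmxA.
  have /bform0/matrixP/(_ 0 0) := sX _ _ (AX i) (AX j).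
  rewrite tr_row -row_mul !mxE => h; rewrite -[RHS]h.
  by apply: eq_bigr => l _; rewrite [row i _ _ _]mxE [col j _ _ _]mxE.
have := mulmx0_rank_max ABA; have := mxrank_mul_min B A^T.
by rewrite mxrank_tr rA; lia.
Qed.

Lemma totally_singular_span (F : fieldType) (n : nat) (B : 'M[F]_n) (E : seq 'rV[F]_n) :
  {in E &, forall v w, v *m B *m w^T = 0} -> totally_singular B <<E>>%VS.
Proof. by move=> EE x y xE yE; apply/bform0; apply: span_singular EE _ _ xE yE. Qed.

Lemma witt_indexE (F : fieldType) (n d s nu : nat) (B : 'M[F]_n) (E : seq 'rV[F]_n) :
  n = (d + s.*2)%N -> \rank B = s.*2 -> size E = (d + s)%N -> free E ->
  {in E &, forall v w, v *m B *m w^T = 0} -> is_witt_index B nu -> nu = (d + s)%N.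
Proof.
move=> nds rB sE fE EE [[X [/dim_singular sX dX]] maxnu].
have := maxnu _ (totally_singular_span EE); rewrite (eqP fE) sE.
by move: sX; rewrite rB dX; lia.
Qed.

Lemma seq_nilpotent (F : fieldType) (n : nat) (U : 'M[F]_n) (E : seq 'rV[F]_n) :
  (forall i, (i < size E)%N -> E`_i *m U \in <<take i E>>%VS) ->
  forall k y, (k <= size E)%N -> y \in <<take k E>>%VS -> y *m U ^+ k = 0.
Proof.
move=> UE; elim=> [|k IH] y lek.
  by rewrite take0 span_nil memv0 => /eqP ->; rewrite mul0mx.
rewrite (take_nth 0) // -cats1 span_cat => /memv_addP[v vE [w]].
rewrite span_seq1 => /vlineP[a ->] ->.
rewrite mulmxDl exprSr -mulmxE mulmxA IH ?mul0mx ?add0r //; last exact: ltnW.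
by rewrite mulmxE -exprSr exprS -mulmxE mulmxA -!scalemxAl IH ?scaler0 ?UE // ltnW.
Qed.

(** [U^nu] kills the span of [E]; by self-adjointness its image is orthogonal to that span, hence
    inside it by maximality. So [U^(2 nu) = 0] on the whole space. *)
Lemma adapted_nilpotent (F : fieldType) (n nu : nat) (B U : 'M[F]_n) (E : seq 'rV[F]_n) :
  B^T = - B -> (forall x : 'rV[F]_n, x *m B *m x^T = 0) ->
  is_witt_index B nu -> size E = nu -> free E ->
  {in E &, forall v w, v *m B *m w^T = 0} -> selfadj B U ->
  (forall i, (i < nu)%N -> E`_i *m U \in <<take i E>>%VS) -> nilpotent_mx U.
Proof.
move=> sB altB [_ maxnu] sE fE EE saU UE.
have kE y : y \in <<E>>%VS -> y *m U ^+ nu = 0.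
  rewrite -{1}(take_size E) sE => yE.
  by apply: seq_nilpotent yE; rewrite sE.
have perp v : (forall w, w \in E -> w *m B *m v^T = 0) -> v \in <<E>>%VS.
  move=> vE; have /maxnu : totally_singular B <<v :: E>>%VS.
    apply: totally_singular_span => x y; rewrite !inE.
    move=> /orP[/eqP-> | xE] /orP[/eqP-> | yE] //; [| exact: vE | exact: EE].
    by apply: trmx_inj; rewrite !trmx_mul trmxK sB mulNmx mulmxN mulmxA vE // oppr0 trmx0.
  rewrite -sE -(eqP fE) => le_dim.
  have /eqP -> : <<E>>%VS == <<v :: E>>%VS by rewrite eqEdim le_dim span_cons addvSr.
  by rewrite memv_span // mem_head.
have saUk k : U ^+ k *m B = B *m (U ^+ k)^T.
  elim: k => [|k IH]; first by rewrite expr0 trmx1 mul1mx mulmx1.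
  by rewrite {1}exprSr exprS -!mulmxE -mulmxA saU trmx_mul !mulmxA IH.
exists (nu + nu)%N; apply/row_matrixP=> i; rewrite row0 rowE exprD -mulmxE mulmxA.
apply: (kE _); apply: (perp _) => w wE; rewrite trmx_mul mulmxA -(mulmxA w) -saUk.
by rewrite mulmxA kE ?mul0mx // memv_span.
Qed.

(** The diagonal coefficient [a] is the eigenvalue of [U] on a one-dimensional quotient of
    consecutive flag members, hence 0 for nilpotent [U]. *)
Lemma stabilized_adapted (F : fieldType) (n nu : nat) (U : 'M[F]_n) (E : seq 'rV[F]_n) :
  size E = nu -> free E -> nilpotent_mx U ->
  stabilizes_flag U (fun i => <<take i E>>%VS) nu ->
  forall i, (i < nu)%N -> E`_i *m U \in <<take i E>>%VS.
Proof.
move=> sE fE [k Uk] stab i lt_i.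
have Ei : E`_i \notin <<take i E>>%VS.
  have: free (rcons (take i E) E`_i).
    rewrite -take_nth ?sE //; move: fE; rewrite -{1}(cat_take_drop i.+1 E).
    exact: catl_free.
  have p : perm_eq (rcons (take i E) E`_i) (E`_i :: take i E) by rewrite perm_rcons.
  by rewrite (perm_free p) free_cons => /andP[].
have : E`_i *m U \in <<take i.+1 E>>%VS.
  by apply: stab => //; rewrite memv_span // (take_nth 0) ?sE // mem_rcons mem_head.
rewrite (take_nth 0) ?sE // -cats1 span_cat => /memv_addP[v vE [w]].
rewrite span_seq1 => /vlineP[a ->] EU.
suff a0 : a = 0 by rewrite EU a0 scale0r addr0.
apply/eqP; apply: contraNT Ei => a0.
have EUj j : E`_i *m U ^+ j - a ^+ j *: E`_i \in <<take i E>>%VS.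
  elim: j => [|j IH]; first by rewrite !expr0 mulmx1 scale1r subrr mem0v.
  have -> : E`_i *m U ^+ j.+1 - a ^+ j.+1 *: E`_i =
     (E`_i *m U ^+ j - a ^+ j *: E`_i) *m U + a ^+ j *: v.
    rewrite mulmxBl -mulmxA mulmxE -exprSr -scalemxAl EU scalerDr scalerA.
    by rewrite -exprSr opprD addrA [RHS]addrAC subrK.
  by rewrite memvD ?memvZ // stab // ltnW.
have := EUj k; rewrite Uk mulmx0 sub0r memvN => h.
have := memvZ (a ^+ k)^-1 h; rewrite scalerA mulVf ?scale1r //.
by rewrite expf_neq0.
Qed.

Theorem mainTheorem6 (F : fieldType) (n : nat) (B : 'M[F]_n) (nu r : nat)
  (Vs : {vspace 'M[F]_n}) :
  (2%:R : F) != 0 ->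
  alt_form B ->
  is_witt_index B nu ->
  r = \rank B ->
  (forall U, U \in Vs -> b_alternating B U) ->
  (forall U, U \in Vs -> nilpotent_mx U) ->
  (\dim Vs)%:Z = ('C(n - r, 2) + r * (n - r))%:Z
                 + (nu%:Z - n%:Z + r%:Z) * (n%:Z - nu%:Z - 1) ->
  exists Fl : nat -> {vspace 'rV[F]_n},
    pc_singular_flag B Fl nu /\
    (forall y, y \in Fl (n - r)%N <-> (forall x, bform B x y = 0)) /\
    (forall U : 'M[F]_n,
       U \in Vs <-> (nilpotent_mx U /\ b_alternating B U /\ stabilizes_flag U Fl nu)).
Proof.
move=> F2 altB wittB -> altV nilV dimV.
have altB0 (x : 'rV_n) : x *m B *m x^T = 0 by apply/bform0.
have sB := alternating_skew altB0.
have [d [s [E0 [nds rB sE0 fE0 EE0]]]] := witt_decomposition F2 sB.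
have nuE := witt_indexE nds rB sE0 fE0 EE0 wittB.
have nilS : nil_space B Vs.
  by move=> U UV; split; [apply/(b_alternatingP _ F2 sB)/altV | apply: nilV].
have dimS : \dim Vs = opt_dim d s.
  have nrd : (n - \rank B)%N = d by lia.
  have e1 : nu%:Z - n%:Z + (\rank B)%:Z = s%:Z by lia.
  have e2 : n%:Z - nu%:Z - 1 = s%:Z - 1 by lia.
  move: (\dim Vs) dimV => D; rewrite e1 e2 nrd rB /opt_dim -muln2.
  (* The split on [s] reconciles the truncated predecessor in [opt_dim] with the integer [s - 1]; at
     [s = 0] both products vanish. *)
  by case: (s) => [|t] /=; lia.
have [E [sE fE EE RE SE]] := adapted_exists F2 nds sB rB nilS dimS.
have nrd : (n - \rank B)%N = d by lia.
exists (fun i => <<take i E>>%VS); split; [split; [|split]|split].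
- move=> i le_i; have : free (take i E).
    by move: fE; rewrite -{1}(cat_take_drop i E); apply: catl_free.
  by move/eqP=> ->; rewrite size_takel // sE -nuE.
- move=> i lt_i; rewrite (take_nth 0) ?sE -?nuE // -cats1 span_cat.
  exact: addvSl.
- by rewrite nuE -sE take_size; apply: totally_singular_span.
- move=> y; rewrite nrd -RE; split=> [yB x | xy].
    apply/bform0; apply: trmx_inj.
    by rewrite !trmx_mul trmxK sB mulNmx mulmxN mulmxA yB mul0mx oppr0 trmx0.
  apply: trmx_inj; apply/row_matrixP=> i; rewrite trmx0 row0 trmx_mul sB mulNmx.
  have /bform0 := xy (delta_mx 0 i); rewrite -rowE -row_mul linearN /= => ->.
  by rewrite oppr0.
move=> U; rewrite -nuE in sE SE; split=> [UV | [nilU [/(b_alternatingP _ F2 sB) saU stabU]]].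
  split; [exact: nilV | split; [exact: altV |]].
  move=> i le_i y; elim: i le_i y => [|i IH] lt_i y.
    by rewrite take0 span_nil memv0 => /eqP->; rewrite mul0mx mem0v.
  rewrite (take_nth 0) ?sE // -cats1 span_cat => /memv_addP[v vE [w]].
  rewrite span_seq1 => /vlineP[a ->] ->; rewrite mulmxDl -scalemxAl.
  by apply/(subvP (addvSl _ _))/memvD; [apply: IH => //; apply: ltnW | rewrite memvZ // SE].
have UE := stabilized_adapted sE fE nilU stabU.
(* Adjoining [U] keeps a space of nilpotent self-adjoint maps, by triangularity along [E];
   optimality of [Vs] then forces [U] into it. *)
have : (\dim (Vs + <[U]>)%VS <= opt_dim d s)%N.
  apply: (bound F2 nds sB rB) => _ /memv_addP[V VV [_ /vlineP[a ->] ->]].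
  have saW : selfadj B (V + a *: U).
    have [saV _] := nilS _ VV.
    rewrite /selfadj mulmxDl -scalemxAl saV saU [(_ + _)^T]linearD /= [(_ *: _)^T]linearZ.
    by rewrite /= mulmxDr -scalemxAr.
  split=> //; apply: adapted_nilpotent sB altB0 wittB sE fE EE saW _ => i lt_i.
  by rewrite mulmxDr -scalemxAr; apply: memvD; [exact: SE | apply: memvZ; exact: UE].
rewrite -dimS => le_dim.
have /eqP -> : Vs == (Vs + <[U]>)%VS by rewrite eqEdim addvSl.
by rewrite memvE addvSr.
Qed.
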